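(* Let $\mathcal{A}$ and $\mathcal{B}$ be unital associative complex algebras. Any homomorphism $\varphi:\mathcal{A}\to\mathcal{B}$ of unital algebras mapping the center $Z(\mathcal{A})$ of $\mathcal{A}$ into the center $Z(\mathcal{B})$ of $\mathcal{B}$ has a unique extension $\Omega_Z(\varphi):\Omega_Z(\mathcal{A})\to\Omega_Z(\mathcal{B})$ as a homomorphism of graded differential algebras.
   Context: A graded differential algebra is a unital associative complex $\mathbb{Z}$-graded algebra with a linear map $d$ of degree $1$ satisfying $d(xy)=d(x)y+(-1)^m x\,d(y)$ for $x$ of degree $m$, and $d^2=0$. Homomorphisms of graded differential algebras are unital algebra homomorphisms of degree $0$ commuting with the differentials. For a unital associative complex algebra $\mathcal{A}$ with center $Z(\mathcal{A})$, let $\Omega^1_u(\mathcal{A})\subset\mathcal{A}\otimes_{\mathbb{C}}\mathcal{A}$ be the kernel of the product map $x\otimes y\mapsto xy$, an $(\mathcal{A},\mathcal{A})$-bimodule, with derivation $d_u(x)=1\otimes x-x\otimes1$. Let $\Omega_u(\mathcal{A})=\bigoplus_{n\ge0}\Omega^n_u(\mathcal{A})$ be the tensor algebra over $\mathcal{A}$ of this bimodule ($\Omega^0_u(\mathcal{A})=\mathcal{A}$ and $\Omega^n_u(\mathcal{A})$ is the $n$-fold tensor power of $\Omega^1_u(\mathcal{A})$ over $\mathcal{A}$); $d_u$ extends uniquely to a differential on $\Omega_u(\mathcal{A})$, making it a graded differential algebra. Let $[Z(\mathcal{A}),\Omega^1_u(\mathcal{A})]\subset\Omega^1_u(\mathcal{A})$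 be the subbimodule spanned by the elements $z\omega-\omega z$ ($z\in Z(\mathcal{A})$, $\omega\in\Omega^1_u(\mathcal{A})$), and let $I_Z$ be the two-sided ideal of $\Omega_u(\mathcal{A})$ generated by $[Z(\mathcal{A}),\Omega^1_u(\mathcal{A})]$ and $d_u([Z(\mathcal{A}),\Omega^1_u(\mathcal{A})])$. Then $I_Z$ is graded and stable under $d_u$, and $\Omega_Z(\mathcal{A})=\Omega_u(\mathcal{A})/I_Z$ is a graded differential algebra with $\Omega^0_Z(\mathcal{A})=\mathcal{A}$. *)

(* Defs.v *)
From HB Require Import structures.
From mathcomp Require Import all_boot all_algebra.
From mathcomp Require Import boolp freeg.

Set Implicit Arguments.
Unset Strict Implicit.
Unset Printing Implicit Defensive.

Import GRing.Theory.

Local Open Scope ring_scope.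

(* Unital associative algebras over [K].  The library's [algType] imposes
   [1 != 0]; here the zero algebra is allowed. *)
Record ualg (K : pzRingType) := UAlg {
  ualg_lmod : lmodType K;
  ualg_one : ualg_lmod;
  ualg_mul : ualg_lmod -> ualg_lmod -> ualg_lmod;
  ualg_mulA : associative ualg_mul;
  ualg_mul1 : left_id ualg_one ualg_mul;
  ualg_mulr1 : right_id ualg_one ualg_mul;
  ualg_linl : forall b, linear (ualg_mul^~ b);
  ualg_linr : forall a, linear (ualg_mul a)
}.

Definition ualg_sort (K : pzRingType) (A : ualg K) : Type := ualg_lmod A.
Coercion ualg_sort : ualg >-> Sortclass.

Section AlgebraInstances.
Variables (K : pzRingType) (A : ualg K).

HB.instance Definition _ := GRing.Lmodule.on (ualg_sort A).

Let mulDl : left_distributive (@ualg_mul K A) +%R.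
Proof. by move=> a b c; have := ualg_linl c 1 a b; rewrite !scale1r. Qed.
Let mulDr : right_distributive (@ualg_mul K A) +%R.
Proof. by move=> a b c; have := ualg_linr a 1 b c; rewrite !scale1r. Qed.

HB.instance Definition _ := GRing.Zmodule_isPzRing.Build (ualg_sort A)
  (@ualg_mulA K A) (@ualg_mul1 K A) (@ualg_mulr1 K A) mulDl mulDr.

Lemma mul_linl (b : A) : linear (fun a : A => a * b).
Proof. exact: (@ualg_linl K A b). Qed.
Lemma mul_linr (a : A) : linear (fun b : A => a * b).
Proof. exact: (@ualg_linr K A a). Qed.

End AlgebraInstances.

Section AlgebraExamples.

Let alg_linl (K : pzRingType) (A : algType K) (b : A) : linear (fun a : A => a * b).
Proof. by move=> c x y; rewrite mulrDl scalerAl. Qed.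
Let alg_linr (K : pzRingType) (A : algType K) (a : A) : linear (fun b : A => a * b).
Proof. by move=> c x y; rewrite mulrDr scalerAr. Qed.

Definition ualg_of (K : pzRingType) (A : algType K) : ualg K :=
  UAlg (@mulrA A) (@mul1r A) (@mulr1 A) (@alg_linl K A) (@alg_linr K A).

Let base_linl (K : comPzRingType) (b : K) : linear (fun a : K^o => (a * b : K^o)).
Proof. by move=> c x y; rewrite mulrDl [RHS]/GRing.add /= /GRing.scale /= mulrA. Qed.
Let base_linr (K : comPzRingType) (a : K) : linear (fun b : K^o => (a * b : K^o)).
Proof. by move=> c x y; rewrite mulrDr /GRing.scale /= mulrCA. Qed.

Definition base_ualg (K : comPzRingType) : ualg K :=
  @UAlg K K^o 1 *%R (@mulrA K) (@mul1r K) (@mulr1 K) (@base_linl K) (@base_linr K).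

End AlgebraExamples.

Definition is_alg_hom (K : pzRingType) (A B : ualg K) (f : A -> B) : Prop :=
  linear f /\ monoid_morphism f.

Definition central (A : pzRingType) (z : A) : Prop := forall x : A, GRing.comm z x.

Section LinearMaps.
Variables (K : pzRingType) (U V : lmodType K).

Definition mklin (f : U -> V) (lf : linear f) : {linear U -> V} :=
  HB.pack f (GRing.isLinear.Build K U V *:%R f lf).

Lemma lin0 (f : U -> V) : linear f -> f 0 = 0.
Proof. by move=> lf; exact: (linear0 (mklin lf)). Qed.
Lemma linD (f : U -> V) : linear f -> {morph f : x y / x + y}.
Proof. by move=> lf; exact: (linearD (mklin lf)). Qed.
Lemma linN (f : U -> V) : linear f -> {morph f : x / - x}.
Proof. by move=> lf; exact: (linearN (mklin lf)). Qed.
Lemma linB (f : U -> V) : linear f -> {morph f : x y / x - y}.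
Proof. by move=> lf; exact: (linearB (mklin lf)). Qed.
Lemma linZ (f : U -> V) : linear f -> forall c, {morph f : x / c *: x}.
Proof. by move=> lf c; exact: (scalable_linear lf). Qed.
Lemma lin_sum (f : U -> V) : linear f -> forall (I : Type) (r : seq I) P F,
  f (\sum_(i <- r | P i) F i) = \sum_(i <- r | P i) f (F i).
Proof. by move=> lf I r P F; exact: (linear_sum (mklin lf)). Qed.

End LinearMaps.

Lemma lin_comp (K : pzRingType) (U V W : lmodType K) (f : U -> V) (g : V -> W) :
  linear f -> linear g -> linear (fun x => g (f x)).
Proof. by move=> lf lg c x y; rewrite lf lg. Qed.

Section Span.
Variables (K : pzRingType) (V : lmodType K).

Inductive in_span (G : V -> Prop) : V -> Prop :=
| in_span0 : in_span G 0
| in_spanZ c g v : G g -> in_span G v -> in_span G (c *: g + v).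

Lemma in_spanP (G : V -> Prop) (c : K) (u v : V) :
  in_span G u -> in_span G v -> in_span G (c *: u + v).
Proof.
move=> Gu Gv; elim: Gu => [|b g w Gg _ IH]; first by rewrite scaler0 add0r.
by rewrite scalerDr scalerA -addrA; apply: in_spanZ.
Qed.

Definition span (G : V -> Prop) : V -> bool := fun v => `[< in_span G v >].

Lemma spanP G v : span G v <-> in_span G v.
Proof. by split=> /asboolP. Qed.

Lemma span_zmod (G : V -> Prop) : zmod_closed (span G).
Proof.
split=> [|u v]; first by apply/spanP; exact: in_span0.
move=> /spanP Gu /spanP Gv; apply/spanP.
by rewrite addrC -scaleN1r; exact: in_spanP.
Qed.

HB.instance Definition _ (G : V -> Prop) :=
  GRing.isZmodClosed.Build V (span G) (span_zmod G).

End Span.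

(* The quotient of [V] by the submodule spanned by an arbitrary subset [G];
   membership is decided classically so that representatives can be chosen. *)
Section QuotientModule.
Local Open Scope quotient_scope.
Variables (K : pzRingType) (V : lmodType K) (G : V -> Prop).

Let spanG : zmodClosed V := GRing.ZmodClosed.clone V (span G) _.

Definition qmod : Type := Quotient.quot spanG.
HB.instance Definition _ := Choice.on qmod.
HB.instance Definition _ := GRing.Zmodule.on qmod.

Definition qpi (v : V) : qmod := \pi_(Quotient.quot spanG) v.
Definition qrepr (q : qmod) : V := @repr V (Quotient.quot spanG) q.

Lemma qreprK : cancel qrepr qpi. Proof. exact: reprK. Qed.

Lemma qpi_eq (u v : V) : qpi u = qpi v <-> in_span G (u - v).
Proof.
rewrite -spanP; split=> [/eqP|h]; first by rewrite /qpi -Quotient.idealrBE.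
by apply/eqP; rewrite /qpi -Quotient.idealrBE.
Qed.

Lemma qpiD : {morph qpi : u v / u + v}.
Proof. by move=> u v; rewrite /qpi [LHS]Quotient.pi_add. Qed.

Lemma qrepr_pi (v : V) : in_span G (qrepr (qpi v) - v).
Proof. by apply/qpi_eq; rewrite qreprK. Qed.

Definition qscale (c : K) (q : qmod) : qmod := qpi (c *: qrepr q).

Lemma qscale_pi c v : qscale c (qpi v) = qpi (c *: v).
Proof. apply/qpi_eq; rewrite -scalerBr -[X in in_span _ X]addr0.
by apply: in_spanP; [exact: qrepr_pi | exact: in_span0]. Qed.

Lemma qscaleA c d q : qscale c (qscale d q) = qscale (c * d) q.
Proof. by rewrite -[q]qreprK !qscale_pi scalerA. Qed.
Lemma qscale1 : left_id 1 qscale.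
Proof. by move=> q; rewrite -[q]qreprK !qscale_pi scale1r. Qed.
Lemma qscaleDr : right_distributive qscale +%R.
Proof.
by move=> c p q; rewrite -[p]qreprK -[q]qreprK -qpiD !qscale_pi -qpiD scalerDr.
Qed.
Lemma qscaleDl q : {morph qscale^~ q : c d / c + d}.
Proof. by move=> c d; rewrite -[q]qreprK !qscale_pi -qpiD scalerDl. Qed.

HB.instance Definition _ :=
  GRing.Zmodule_isLmodule.Build K qmod qscaleA qscale1 qscaleDr qscaleDl.

Lemma qpi_lin : linear qpi.
Proof. by move=> c u v; rewrite qpiD -qscale_pi. Qed.

Lemma qpi0P (v : V) : qpi v = 0 <-> in_span G v.
Proof. by rewrite -(lin0 qpi_lin) qpi_eq subr0. Qed.

Lemma qlift_pi (W : lmodType K) (f : V -> W) (v : V) :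
  linear f -> (forall g, G g -> f g = 0) -> f (qrepr (qpi v)) = f v.
Proof.
move=> lf f0; apply/eqP; rewrite -subr_eq0 -(linB lf); apply/eqP.
elim: (qrepr_pi v) => [|c g w Gg _ IH]; first exact: lin0.
by rewrite lf IH f0 // scaler0 addr0.
Qed.

End QuotientModule.

Arguments qpi {K V G} v.
Arguments qrepr {K V G} q.

(* A ([A], [B])-bimodule is a [K]-module with commuting left and right actions,
   bilinear over [K]. *)
Record bimod (K : fieldType) (A B : ualg K) := Bimod {
  bm_sort :> lmodType K;
  lact : A -> bm_sort -> bm_sort;
  ract : bm_sort -> B -> bm_sort;
  lact_linl : forall m, linear (lact^~ m);
  lact_linr : forall a, linear (lact a);
  lactM : forall a b m, lact (a * b) m = lact a (lact b m);
  lact1 : forall m, lact 1 m = m;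
  ract_linl : forall b, linear (ract^~ b);
  ract_linr : forall m, linear (ract m);
  ractM : forall m a b, ract m (a * b) = ract (ract m a) b;
  ract1 : forall m, ract m 1 = m;
  lractA : forall a m b, ract (lact a m) b = lact a (ract m b)
}.

Section RegularBimodules.
Variables (K : fieldType) (A : ualg K).

Let lmulE (a b m : A) : a * b * m = a * (b * m). Proof. by rewrite mulrA. Qed.
Let rmulE (m a b : A) : m * (a * b) = m * a * b. Proof. by rewrite mulrA. Qed.
Let lrmulE (a m b : A) : a * m * b = a * (m * b). Proof. by rewrite mulrA. Qed.

Definition reg_bimod : bimod A A :=
  @Bimod K A A (ualg_sort A) (fun a m => a * m) (fun m a => m * a)
    (@mul_linl K A) (@mul_linr K A) lmulE (@mul1r A)
    (@mul_linl K A) (@mul_linr K A) rmulE (@mulr1 A) lrmulE.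

Let sc_linl (m : A) : linear (fun c : base_ualg K => (c : K) *: m).
Proof. by move=> c x y; rewrite scalerDl -scalerA. Qed.
Let sc_linr (c : base_ualg K) : linear (fun m : A => (c : K) *: m).
Proof. by move=> d x y; rewrite scalerDr !scalerA mulrC. Qed.
Let scA (c d : base_ualg K) (m : A) : (c * d : K) *: m = (c : K) *: ((d : K) *: m).
Proof. by rewrite scalerA. Qed.
Let scAr (m : A) (c d : base_ualg K) : (c * d : K) *: m = (d : K) *: ((c : K) *: m).
Proof. by rewrite scalerA mulrC. Qed.
Let scl (a m : A) (c : base_ualg K) : (c : K) *: (a * m) = a * ((c : K) *: m).
Proof. by rewrite (linZ (mul_linr a)). Qed.
Let scr (c : base_ualg K) (m a : A) : (c : K) *: m * a = (c : K) *: (m * a).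
Proof. by rewrite (linZ (mul_linl a)). Qed.

(* [A] as an ([A], [K])-bimodule and as a ([K], [A])-bimodule, so that the
   ([A], [A])-bimodule [A (x)_K A] is an instance of [tens] below. *)
Definition lreg_bimod : bimod A (base_ualg K) :=
  @Bimod K A (base_ualg K) (ualg_sort A) (fun a m => a * m) (fun m c => (c : K) *: m)
    (@mul_linl K A) (@mul_linr K A) lmulE (@mul1r A)
    sc_linr sc_linl scAr (@scale1r K (ualg_sort A)) scl.

Definition rreg_bimod : bimod (base_ualg K) A :=
  @Bimod K (base_ualg K) A (ualg_sort A) (fun c m => (c : K) *: m) (fun m a => m * a)
    sc_linl sc_linr scA (@scale1r K (ualg_sort A))
    (@mul_linl K A) (@mul_linr K A) rmulE (@mulr1 A) scr.

End RegularBimodules.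

Section Tensor.
Variables (K : fieldType) (A B C : ualg K) (M : bimod A B) (N : bimod B C).

(* Bilinear over [K] and balanced over [B]. *)
Definition balanced (V : lmodType K) (f : M -> N -> V) : Prop :=
  [/\ forall n, linear (f^~ n), forall m, linear (f m)
    & forall m b n, f (ract m b) n = f m (lact b n)].

(* [M (x)_B N] is the free [K]-module on [M * N] modulo the relations making
   [(m, n) |-> m (x) n] bilinear over [K] and balanced over [B]. *)
Inductive tens_rel : {freeg (M * N)%type / K} -> Prop :=
| tens_rel_linl c m m' n :
    tens_rel (<< (c *: m + m', n) >> - (c *: << (m, n) >> + << (m', n) >>))
| tens_rel_linr c m n n' :
    tens_rel (<< (m, c *: n + n') >> - (c *: << (m, n) >> + << (m, n') >>))
| tens_rel_bal m b n :
    tens_rel (<< (ract m b, n) >> - << (m, lact b n) >>).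

Definition tens_mod : lmodType K := qmod tens_rel.

Definition tmk (m : M) (n : N) : tens_mod := qpi << (m, n) >>.

(* The linear map on [M (x)_B N] induced by a balanced bilinear map. *)
Definition tlift (V : lmodType K) (f : M -> N -> V) (t : tens_mod) : V :=
  fglift (fun mn => f mn.1 mn.2) (qrepr t).

Lemma fglift_lin (V : lmodType K) (X : choiceType) (f : X -> V) :
  linear (fglift f : {freeg X / K} -> V).
Proof.
move=> c x y.
have fB := lift_is_additive f.
have fD u v : fglift f (u + v) = fglift f u + fglift f v.
  have fN w : fglift f (- w) = - fglift f w.
    by rewrite -[- w]sub0r fB -(subrr (0 : {freeg X / K})) fB subrr sub0r.
  by rewrite -{1}[v]opprK fB fN opprK.
rewrite fD; congr (_ + _).
elim/freeg_ind_dom0: x => [|k u D _ _ IH].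
  by rewrite scaler0 -(subrr (0 : {freeg X / K})) fB subrr scaler0.
rewrite scalerDr !fD scalerDr IH; congr (_ + _).
suff -> : c *: << k *g u >> = << c * k *g u >> by rewrite !liftU scalerA.
by apply/eqP/freeg_eqP => z; rewrite coeffZ !coeffU mulrA.
Qed.

Lemma tmk_bal : balanced tmk.
Proof.
have rel g : tens_rel g -> in_span tens_rel g.
  by move=> h; rewrite -[g]scale1r -[_ *: _]addr0; apply: in_spanZ => //; exact: in_span0.
split=> [n c m m'|m c n n'|m b n].
- rewrite -(@qpi_lin _ _ tens_rel c << (m, n) >> << (m', n) >>).
  by apply/qpi_eq/rel; exact: tens_rel_linl.
- rewrite -(@qpi_lin _ _ tens_rel c << (m, n) >> << (m, n') >>).
  by apply/qpi_eq/rel; exact: tens_rel_linr.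
- by apply/qpi_eq/rel; exact: tens_rel_bal.
Qed.

Lemma tlift_tmk (V : lmodType K) (f : M -> N -> V) m n :
  balanced f -> tlift f (tmk m n) = f m n.
Proof.
case=> fl fr fb; rewrite /tlift /tmk qlift_pi; last 2 first.
- exact: fglift_lin.
- move=> _ [c m1 m2 n1|c m1 n1 n2|m1 b n1];
    rewrite (linB (fglift_lin _)) ?(linD (fglift_lin _)) ?(linZ (fglift_lin _)) !liftU !scale1r /=.
  + by rewrite fl subrr.
  + by rewrite fr subrr.
  + by rewrite fb subrr.
by rewrite liftU scale1r.
Qed.

Lemma tens_ind (P : tens_mod -> Prop) :
  P 0 -> (forall m n t, P t -> P (tmk m n + t)) -> forall t, P t.
Proof.
move=> P0 PS t; rewrite -[t]qreprK.
elim/freeg_ind_dom0: (qrepr t) => [|k [m n] D _ _ IH].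
  by rewrite (lin0 (@qpi_lin _ _ _)).
rewrite qpiD; suff -> : qpi << k *g (m, n) >> = tmk (k *: m) n by exact: PS.
rewrite (linZ (let: And3 h _ _ := tmk_bal in h n)) -(linZ (@qpi_lin _ _ _)); congr qpi.
by apply/eqP/freeg_eqP => z; rewrite coeffZ !coeffU mul1r.
Qed.

Lemma tlift_lin (V : lmodType K) (f : M -> N -> V) : balanced f -> linear (tlift f).
Proof.
case=> fl fr fb c s t.
have kill u : tens_rel u -> fglift (fun mn => f mn.1 mn.2) u = 0.
  case=> [c1 m1 m2 n1|c1 m1 n1 n2|m1 b n1];
    rewrite (linB (fglift_lin _)) ?(linD (fglift_lin _)) ?(linZ (fglift_lin _)) !liftU !scale1r /=.
  - by rewrite fl subrr.
  - by rewrite fr subrr.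
  - by rewrite fb subrr.
rewrite /tlift -[s in LHS]qreprK -[t in LHS]qreprK -qpi_lin qlift_pi //.
  exact: fglift_lin.
exact: fglift_lin.
Qed.

Lemma tens_linE (V : lmodType K) (f g : tens_mod -> V) :
  linear f -> linear g -> (forall m n, f (tmk m n) = g (tmk m n)) -> f =1 g.
Proof.
move=> lf lg fg t; elim/tens_ind: t => [|m n t IH]; first by rewrite !lin0.
by rewrite (linD lf) (linD lg) fg IH.
Qed.

Let lact_bal a : balanced (fun m n => tmk (lact a m) n).
Proof.
have [tl tr tb] := tmk_bal.
split=> [n|m|m b n]; last by rewrite -tb lractA.
- exact: (lin_comp (lact_linr a) (tl n)).
- exact: tr.
Qed.

Let ract_bal c : balanced (fun m n => tmk m (ract n c)).
Proof.
have [tl tr tb] := tmk_bal.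
split=> [n|m|m b n]; last by rewrite tb lractA.
- exact: tl.
- exact: (lin_comp (ract_linl c) (tr m)).
Qed.

Definition tens_lact (a : A) : tens_mod -> tens_mod :=
  tlift (fun m n => tmk (lact a m) n).
Definition tens_ract (t : tens_mod) (c : C) : tens_mod :=
  tlift (fun m n => tmk m (ract n c)) t.

Let lE a m n : tens_lact a (tmk m n) = tmk (lact a m) n.
Proof. exact: tlift_tmk. Qed.
Let rE c m n : tens_ract (tmk m n) c = tmk m (ract n c).
Proof. exact: tlift_tmk. Qed.
Let llin a : linear (tens_lact a). Proof. exact: tlift_lin. Qed.
Let rlin c : linear (tens_ract^~ c). Proof. exact: tlift_lin. Qed.

Let llin' t : linear (tens_lact^~ t).
Proof.
have [tl tr tb] := tmk_bal.
move=> k a b; elim/tens_ind: t => [|m n t IH]; first by rewrite !(lin0 (llin _)) scaler0 addr0.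
by rewrite !(linD (llin _)) IH !lE lact_linl tl scalerDr addrACA.
Qed.

Let rlin' t : linear (tens_ract t).
Proof.
have [tl tr tb] := tmk_bal.
move=> k a b; elim/tens_ind: t => [|m n t IH].
  by rewrite !(lin0 (rlin _)) scaler0 addr0.
by rewrite !(linD (rlin _)) IH !rE ract_linr tr scalerDr addrACA.
Qed.

Let lM a b t : tens_lact (a * b) t = tens_lact a (tens_lact b t).
Proof.
elim/tens_ind: t => [|m n t IH]; first by rewrite !(lin0 (llin _)).
by rewrite !(linD (llin _)) IH !lE lactM.
Qed.
Let l1 t : tens_lact 1 t = t.
Proof.
elim/tens_ind: t => [|m n t IH]; first by rewrite !(lin0 (llin _)).
by rewrite !(linD (llin _)) IH !lE lact1.
Qed.
Let rM t a b : tens_ract t (a * b) = tens_ract (tens_ract t a) b.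
Proof.
elim/tens_ind: t => [|m n t IH]; first by rewrite !(lin0 (rlin _)).
by rewrite !(linD (rlin _)) IH !rE ractM.
Qed.
Let r1 t : tens_ract t 1 = t.
Proof.
elim/tens_ind: t => [|m n t IH]; first by rewrite !(lin0 (rlin _)).
by rewrite !(linD (rlin _)) IH !rE ract1.
Qed.
Let lrA a t c : tens_ract (tens_lact a t) c = tens_lact a (tens_ract t c).
Proof.
elim/tens_ind: t => [|m n t IH].
  by rewrite !(lin0 (llin _)) !(lin0 (rlin _)) (lin0 (llin _)).
by rewrite !(linD (llin _), linD (rlin _)) IH !(lE, rE).
Qed.

Definition tens : bimod A C :=
  Bimod llin' llin lM l1 rlin rlin' rM r1 lrA.

Lemma lact_tmk a m n : lact a (tmk m n : tens) = tmk (lact a m) n.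
Proof. exact: lE. Qed.
Lemma ract_tmk m n c : ract (tmk m n : tens) c = tmk m (ract n c).
Proof. exact: rE. Qed.

End Tensor.

Arguments tmk {K A B C M N} m n.
Arguments tens {K A B C} M N.

(* The universal first-order calculus: [Om1] is the kernel of the product map
   [A (x)_K A -> A]. *)
Section Omega1.
Variables (K : fieldType) (A : ualg K).

Definition AxA : bimod A A := tens (lreg_bimod A) (rreg_bimod A).

Definition atens (x y : A) : AxA := @tmk K A _ A (lreg_bimod A) (rreg_bimod A) x y.

Definition mulmap : AxA -> A :=
  @tlift K A _ A (lreg_bimod A) (rreg_bimod A) (ualg_sort A) (fun x y : A => x * y).

Let mul_bal : @balanced K A _ A (lreg_bimod A) (rreg_bimod A) (ualg_sort A)
  (fun x y : A => x * y).
Proof.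
split=> [b|a|x c y]; [exact: mul_linl | exact: mul_linr | rewrite /=].
by rewrite (linZ (mul_linl y)) (linZ (mul_linr x)).
Qed.

Lemma mulmapE x y : mulmap (atens x y) = x * y.
Proof. by rewrite /mulmap /atens tlift_tmk. Qed.
Lemma mulmap_lin : linear mulmap.
Proof. exact: tlift_lin. Qed.
Lemma lact_atens a x y : lact a (atens x y) = atens (a * x) y.
Proof. exact: lact_tmk. Qed.
Lemma ract_atens x y a : ract (atens x y) a = atens x (y * a).
Proof. exact: ract_tmk. Qed.
Lemma atens_linl y : linear (atens^~ y).
Proof. by have [h _ _] := tmk_bal (lreg_bimod A) (rreg_bimod A); exact: h. Qed.
Lemma atens_linr x : linear (atens x).
Proof. by have [_ h _] := tmk_bal (lreg_bimod A) (rreg_bimod A); exact: h. Qed.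

Lemma AxA_ind (P : AxA -> Prop) :
  P 0 -> (forall x y t, P t -> P (atens x y + t)) -> forall t, P t.
Proof. move=> P0 PS; exact: (@tens_ind K A _ A (lreg_bimod A) (rreg_bimod A) P P0 PS). Qed.

Lemma mulmap_lact a t : mulmap (lact a t) = a * mulmap t.
Proof.
elim/AxA_ind: t => [|x y t IH].
  by rewrite (lin0 (lact_linr _)) (lin0 mulmap_lin) mulr0.
by rewrite (linD (lact_linr _)) !(linD mulmap_lin) IH lact_atens !mulmapE mulrDr mulrA.
Qed.
Lemma mulmap_ract a t : mulmap (ract t a) = mulmap t * a.
Proof.
elim/AxA_ind: t => [|x y t IH].
  by rewrite (lin0 (ract_linl _)) (lin0 mulmap_lin) mul0r.
by rewrite (linD (ract_linl _)) !(linD mulmap_lin) IH ract_atens !mulmapE mulrDl mulrA.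
Qed.

Record Om1_type := Om1_Sub { Om1_val : AxA; _ : mulmap Om1_val == 0 }.

HB.instance Definition _ := [isSub for Om1_val].
HB.instance Definition _ := [Choice of Om1_type by <:].

Lemma Om1P (w : Om1_type) : mulmap (Om1_val w) = 0.
Proof. by apply/eqP; case: w. Qed.

Let ker_closed : submod_closed (fun t : AxA => mulmap t == 0).
Proof.
split=> [|c u v]; first by apply/eqP; exact: lin0 mulmap_lin.
by move=> /eqP hu /eqP hv; apply/eqP; rewrite mulmap_lin hu hv scaler0 addr0.
Qed.

HB.instance Definition _ :=
  GRing.SubChoice_isSubLmodule.Build K AxA (fun t => mulmap t == 0) Om1_type ker_closed.

Definition Om1_lmod : lmodType K := Om1_type.

Lemma Om1_val_lin : linear (Om1_val : Om1_lmod -> AxA).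
Proof. by move=> c u v; exact: (linearP (val : Om1_type -> AxA)). Qed.

Let lker a (w : Om1_type) : mulmap (lact a (Om1_val w)) == 0.
Proof. by rewrite mulmap_lact Om1P mulr0. Qed.
Let rker (w : Om1_type) a : mulmap (ract (Om1_val w) a) == 0.
Proof. by rewrite mulmap_ract Om1P mul0r. Qed.

Definition Om1_lact a w : Om1_lmod := Om1_Sub (lker a w).
Definition Om1_ract w a : Om1_lmod := Om1_Sub (rker w a).

Let inj (u v : Om1_lmod) : Om1_val u = Om1_val v -> u = v.
Proof. exact: val_inj. Qed.

Let valL a w : Om1_val (Om1_lact a w) = lact a (Om1_val w). Proof. by []. Qed.
Let valR a w : Om1_val (Om1_ract w a) = ract (Om1_val w) a. Proof. by []. Qed.

Let linl1 w : linear (Om1_lact^~ w).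
Proof. by move=> c a b; apply: inj; rewrite [RHS]Om1_val_lin; exact: lact_linl. Qed.
Let linl2 a : linear (Om1_lact a).
Proof. by move=> c u v; apply: inj; rewrite [RHS]Om1_val_lin !valL Om1_val_lin; exact: lact_linr. Qed.
Let linl3 a b w : Om1_lact (a * b) w = Om1_lact a (Om1_lact b w).
Proof. by apply: inj; rewrite ?(valL, valR) lactM. Qed.
Let linl4 w : Om1_lact 1 w = w.
Proof. by apply: inj; rewrite ?(valL, valR) lact1. Qed.
Let linr1 a : linear (Om1_ract^~ a).
Proof. by move=> c u v; apply: inj; rewrite [RHS]Om1_val_lin !valR Om1_val_lin; exact: ract_linl. Qed.
Let linr2 w : linear (Om1_ract w).
Proof. by move=> c a b; apply: inj; rewrite [RHS]Om1_val_lin; exact: ract_linr. Qed.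
Let linr3 w a b : Om1_ract w (a * b) = Om1_ract (Om1_ract w a) b.
Proof. by apply: inj; rewrite ?(valL, valR) ractM. Qed.
Let linr4 w : Om1_ract w 1 = w.
Proof. by apply: inj; rewrite ?(valL, valR) ract1. Qed.
Let lrA a w b : Om1_ract (Om1_lact a w) b = Om1_lact a (Om1_ract w b).
Proof. by apply: inj; rewrite ?(valL, valR) lractA. Qed.

Definition Om1 : bimod A A :=
  Bimod linl1 linl2 linl3 linl4 linr1 linr2 linr3 linr4 lrA.

Let du_ker x : mulmap (atens 1 x - atens x 1) == 0.
Proof. by rewrite (linB mulmap_lin) !mulmapE mul1r mulr1 subrr. Qed.

Definition du (x : A) : Om1 := Om1_Sub (du_ker x).

Lemma Om1_inj (u v : Om1) : Om1_val u = Om1_val v -> u = v.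
Proof. exact: val_inj. Qed.

Lemma Om1_val_du x : Om1_val (du x) = atens 1 x - atens x 1. Proof. by []. Qed.
Lemma Om1_val_lact a (w : Om1) : Om1_val (lact a w) = lact a (Om1_val w).
Proof. by []. Qed.
Lemma Om1_val_ract (w : Om1) a : Om1_val (ract w a) = ract (Om1_val w) a.
Proof. by []. Qed.

Lemma du_lin : linear du.
Proof.
move=> c x y; apply: Om1_inj; rewrite [RHS]Om1_val_lin !Om1_val_du (atens_linr 1) (atens_linl 1).
by rewrite scalerBr opprD addrACA.
Qed.

Lemma duM x y : du (x * y) = ract (du x) y + lact x (du y).
Proof.
apply: Om1_inj; rewrite [RHS](linD Om1_val_lin) Om1_val_ract Om1_val_lact !Om1_val_du.
rewrite (linB (ract_linl y)) (linB (lact_linr x)) !ract_atens !lact_atens.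
by rewrite !mul1r !mulr1 addrA addrNK.
Qed.

End Omega1.

(* The tensor powers over [A] of an ([A], [A])-bimodule [M]: [A], [M],
   [M (x)_A M], [M (x)_A (M (x)_A M)], ... *)
Section TensorPowers.
Variables (K : fieldType) (A : ualg K) (M : bimod A A).

Fixpoint tpow (n : nat) : bimod A A :=
  match n with
  | 0 => reg_bimod A
  | n'.+1 => match n' with 0 => M | _.+1 => tens M (tpow n') end
  end.

(* The concatenation [M * M^{(x) n} -> M^{(x) n.+1}]. *)
Definition tcons (n : nat) : M -> tpow n -> tpow n.+1 :=
  match n return M -> tpow n -> tpow n.+1 with
  | 0 => fun m a => ract m (a : A)
  | n'.+1 => fun m t => tmk m t
  end.

(* The linear map on [M^{(x) n.+1}] induced by a balanced bilinear map on
   [M * M^{(x) n}]. *)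
Definition tplift (n : nat) (V : lmodType K) : (M -> tpow n -> V) -> tpow n.+1 -> V :=
  match n return (M -> tpow n -> V) -> tpow n.+1 -> V with
  | 0 => fun f m => f m (1 : A)
  | n'.+1 => fun f t => tlift f t
  end.

Lemma tcons_bal n : balanced (@tcons n).
Proof.
case: n => [|n]; last exact: tmk_bal.
split=> [a|m|m b n]; [exact: ract_linl | exact: ract_linr | by rewrite /= ractM].
Qed.

Lemma tplift_cons n (V : lmodType K) (f : M -> tpow n -> V) m t :
  balanced f -> tplift f (tcons m t) = f m t.
Proof.
case: n f t => [|n] f t fb; last exact: tlift_tmk.
by have [_ _ h] := fb; rewrite /= h /= mulr1.
Qed.

Lemma tplift_lin n (V : lmodType K) (f : M -> tpow n -> V) :
  balanced f -> linear (tplift f).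
Proof.
case: n f => [|n] f fb; last exact: tlift_lin.
by have [h _ _] := fb; exact: h.
Qed.

Lemma tpow_ind n (P : tpow n.+1 -> Prop) :
  P 0 -> (forall m t u, P u -> P (tcons m t + u)) -> forall t, P t.
Proof.
case: n P => [|n] P P0 PS; last exact: tens_ind.
move=> m; rewrite -[m]addr0 -[m](ract1 m).
exact: (PS m (1 : A) 0).
Qed.

Lemma tcons_linl n (t : tpow n) : linear (fun m => tcons m t).
Proof. by have [h _ _] := tcons_bal n. Qed.
Lemma tcons_linr n m : linear (@tcons n m).
Proof. by have [_ h _] := tcons_bal n. Qed.
Lemma tcons_ract n m a (t : tpow n) : tcons (ract m a) t = tcons m (lact a t).
Proof. by have [_ _ h] := tcons_bal n. Qed.
Lemma lact_tcons n a m (t : tpow n) : lact a (tcons m t) = tcons (lact a m) t.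
Proof. by case: n t => [|n] t /=; [rewrite lractA | exact: lact_tmk]. Qed.
Lemma ract_tcons n a m (t : tpow n) : ract (tcons m t) a = tcons m (ract t a).
Proof. by case: n t => [|n] t /=; [rewrite ractM | exact: ract_tmk]. Qed.

(* The multiplication [M^{(x) m} * M^{(x) n} -> M^{(x) (m + n)}]:
   [a * y = lact a y] in degree 0 and [(w (x) t) * y = w (x) (t * y)]. *)
Fixpoint tmul (m : nat) : tpow m -> forall n, tpow n -> tpow (m + n) :=
  match m return tpow m -> forall n, tpow n -> tpow (m + n) with
  | 0 => fun a n y => lact (a : A) y
  | m'.+1 => fun x n y =>
      @tplift m' (tpow (m' + n).+1) (fun w t => tcons w (@tmul m' t n y)) x
  end.

Lemma tmul_props m :
  [/\ forall n (y : tpow n), linear (fun x : tpow m => tmul x y),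
      forall n (x : tpow m), linear (fun y : tpow n => tmul x y),
      forall n a (x : tpow m) (y : tpow n), tmul (lact a x) y = lact a (tmul x y)
    & forall n w (t : tpow m) (y : tpow n),
        @tmul m.+1 (tcons w t) n y = tcons w (tmul t y)].
Proof.
have bal m' n (y : tpow n) :
    (forall n (y : tpow n), linear (fun x : tpow m' => tmul x y)) ->
    (forall n a (x : tpow m') (y : tpow n), tmul (lact a x) y = lact a (tmul x y)) ->
    balanced (fun w (t : tpow m') => tcons w (tmul t y)).
  move=> h1 h2; split=> [t|w|w b t].
  - exact: tcons_linl.
  - exact: (lin_comp (h1 n y) (@tcons_linr _ w)).
  - by rewrite tcons_ract h2.
elim: m => [|m [IH1 IH2 IH3 IH4]].
  have h1 n (y : tpow n) : linear (fun x : tpow 0 => tmul x y).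
    exact: (lact_linl y).
  have h3 n a (x : tpow 0) (y : tpow n) : tmul (lact a x) y = lact a (tmul x y).
    exact: (lactM a x y).
  split=> // [n x|n w t y]; first exact: (lact_linr x).
  exact: (@tplift_cons 0 _ _ w t (bal 0 n y h1 h3)).
have h1 n (y : tpow n) : linear (fun x : tpow m.+1 => tmul x y).
  exact: (tplift_lin (bal m n y IH1 IH3)).
have h3 n a (x : tpow m.+1) (y : tpow n) : tmul (lact a x) y = lact a (tmul x y).
  elim/tpow_ind: x => [|w t u IH].
    by rewrite (lin0 (lact_linr a)) (lin0 (h1 n y)) (lin0 (lact_linr a)).
  rewrite (linD (lact_linr a)) !(linD (h1 n y)) (linD (lact_linr a)) IH.
  by rewrite lact_tcons !IH4 [in RHS]lact_tcons.
split=> // [n x c y y'|n w t y].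
  elim/tpow_ind: x => [|w t u IH]; first by rewrite !(lin0 (h1 _ _)) scaler0 addr0.
  rewrite !(linD (h1 _ _)) IH !IH4 IH2 (tcons_linr w) scalerDr.
  by rewrite -!addrA; congr (_ + _); rewrite addrCA.
exact: (@tplift_cons m.+1 _ _ w t (bal m.+1 n y h1 h3)).
Qed.

Lemma tmul_linl m n (y : tpow n) : linear (fun x : tpow m => tmul x y).
Proof. by have [h _ _ _] := tmul_props m. Qed.
Lemma tmul_linr m n (x : tpow m) : linear (fun y : tpow n => tmul x y).
Proof. by have [_ h _ _] := tmul_props m. Qed.
Lemma tmul_lact m n a (x : tpow m) (y : tpow n) : tmul (lact a x) y = lact a (tmul x y).
Proof. by have [_ _ h _] := tmul_props m. Qed.
Lemma tmul_cons m n w (t : tpow m) (y : tpow n) :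
  @tmul m.+1 (tcons w t) n y = tcons w (tmul t y).
Proof. by have [_ _ _ h] := tmul_props m. Qed.

Lemma tmul_ract m n a (x : tpow m) (y : tpow n) :
  tmul (ract x a) y = tmul x (lact a y).
Proof.
elim: m x => [|m IH] x; first exact: (lactM x a y).
elim/tpow_ind: x => [|w t u IHu].
  by rewrite (lin0 (ract_linl a)) !(lin0 (tmul_linl _)).
by rewrite (linD (ract_linl a)) !(linD (tmul_linl _)) IHu ract_tcons !tmul_cons IH.
Qed.

Lemma tmul1l n w (y : tpow n) : @tmul 1 w n y = tcons w y.
Proof.
have -> : w = @tcons 0 w (1 : A) by rewrite /= ract1.
by rewrite tmul_cons /= lact1 ract1.
Qed.

End TensorPowers.

Arguments tcons {K A M n} m t.

Section DirectSum.
Variables (K : fieldType) (T : nat -> lmodType K).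

Record dsum_type := DSum {
  dsum_val :> forall n, T n;
  dsum_fin : exists N, forall n, (N <= n)%N -> dsum_val n = 0
}.

HB.instance Definition _ := gen_eqMixin dsum_type.
HB.instance Definition _ := gen_choiceMixin dsum_type.

Lemma dsumP (x y : dsum_type) : (forall n, x n = y n) -> x = y.
Proof.
case: x y => [f hf] [g hg] /= fg; have {}fg : f = g by exact: functional_extensionality_dep.
by rewrite -{}fg in hg *; congr DSum.
Qed.

Let fin0 : exists N, forall n, (N <= n)%N -> (0 : T n) = 0.
Proof. by exists 0. Qed.
Let finD (x y : dsum_type) : exists N, forall n, (N <= n)%N -> x n + y n = 0.
Proof.
have [[N hN] [N' hN']] := (dsum_fin x, dsum_fin y).
by exists (maxn N N') => n; rewrite geq_max => /andP[h h']; rewrite hN // hN' // addr0.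
Qed.
Let finN (x : dsum_type) : exists N, forall n, (N <= n)%N -> - x n = 0.
Proof. by have [N hN] := dsum_fin x; exists N => n h; rewrite hN // oppr0. Qed.
Let finZ (c : K) (x : dsum_type) : exists N, forall n, (N <= n)%N -> c *: x n = 0.
Proof. by have [N hN] := dsum_fin x; exists N => n h; rewrite hN // scaler0. Qed.

Definition dsum0 := DSum fin0.
Definition dsum_add x y := DSum (finD x y).
Definition dsum_opp x := DSum (finN x).
Definition dsum_scale c x := DSum (finZ c x).

Let addA : associative dsum_add. Proof. by move=> x y z; apply: dsumP => n /=; rewrite addrA. Qed.
Let addC : commutative dsum_add. Proof. by move=> x y; apply: dsumP => n /=; rewrite addrC. Qed.
Let add0 : left_id dsum0 dsum_add. Proof. by move=> x; apply: dsumP => n /=; rewrite add0r. Qed.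
Let addN : left_inverse dsum0 dsum_opp dsum_add.
Proof. by move=> x; apply: dsumP => n /=; rewrite addNr. Qed.

HB.instance Definition _ := GRing.isZmodule.Build dsum_type addA addC add0 addN.

Let scA c d x : dsum_scale c (dsum_scale d x) = dsum_scale (c * d) x.
Proof. by apply: dsumP => n /=; rewrite scalerA. Qed.
Let sc1 : left_id 1 dsum_scale.
Proof. by move=> x; apply: dsumP => n /=; rewrite scale1r. Qed.
Let scDr : right_distributive dsum_scale +%R.
Proof. by move=> c x y; apply: dsumP => n /=; rewrite scalerDr. Qed.
Let scDl x : {morph dsum_scale^~ x : c d / c + d}.
Proof. by move=> c d; apply: dsumP => n /=; rewrite scalerDl. Qed.

HB.instance Definition _ := GRing.Zmodule_isLmodule.Build K dsum_type scA sc1 scDr scDl.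

Definition dsum : lmodType K := dsum_type.

Lemma dsum_val_lin n : linear (fun x : dsum => x n).
Proof. by []. Qed.

Definition inj_fun n (t : T n) : forall k, T k :=
  fun k => if n =P k is ReflectT e then ecast k (T k) e t else 0.

Lemma inj_fun_eq n (t : T n) : inj_fun t n = t.
Proof. by rewrite /inj_fun; case: eqP => // e; rewrite eq_axiomK. Qed.
Lemma inj_fun_neq n (t : T n) k : n != k -> inj_fun t k = 0.
Proof. by rewrite /inj_fun; case: eqP. Qed.

Let inj_fin n (t : T n) : exists N, forall k, (N <= k)%N -> inj_fun t k = 0.
Proof. by exists n.+1 => k h; rewrite inj_fun_neq // neq_ltn h. Qed.

Definition dinj n (t : T n) : dsum := DSum (inj_fin t).

Lemma dinj_eq n (t : T n) : dinj t n = t. Proof. exact: inj_fun_eq. Qed.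
Lemma dinj_neq n (t : T n) k : n != k -> dinj t k = 0. Proof. exact: inj_fun_neq. Qed.

Lemma dinj_lin n : linear (@dinj n).
Proof.
move=> c x y; apply: dsumP => k; rewrite dsum_val_lin.
have [<-|h] := eqVneq n k; first by rewrite !dinj_eq.
by rewrite !dinj_neq // scaler0 addr0.
Qed.

(* The linear map on the direct sum induced by linear maps [f n] on [T n]. *)
Definition dlift (V : lmodType K) (f : forall n, T n -> V) (x : dsum) : V :=
  \sum_(n < projT1 (cid (dsum_fin x))) f n (x n).

Lemma dliftE (V : lmodType K) (f : forall n, T n -> V) (x : dsum) N :
  (forall n, linear (f n)) -> (forall n, (N <= n)%N -> x n = 0) ->
  dlift f x = \sum_(n < N) f n (x n).
Proof.
move=> lf hN; rewrite /dlift; case: cid => /= N' hN'.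
have ext P Q : (P <= Q)%N -> (forall n, (P <= n)%N -> x n = 0) ->
    \sum_(n < P) f n (x n) = \sum_(n < Q) f n (x n).
  move=> PQ hP; rewrite (big_ord_widen Q (fun n => f n (x n)) PQ) [RHS](bigID (fun n : 'I_Q => (n < P)%N)) /=.
  by rewrite [X in _ + X]big1 ?addr0 // => n; rewrite -leqNgt => h; rewrite hP // (lin0 (lf n)).
by have [h|/ltnW h] := leqP N' N; [exact: ext | exact/esym/ext].
Qed.

Lemma dlift_lin (V : lmodType K) (f : forall n, T n -> V) :
  (forall n, linear (f n)) -> linear (dlift f).
Proof.
move=> lf c x y; have [[N hN] [N' hN']] := (dsum_fin x, dsum_fin y).
pose Q := maxn N N'.
have hx n : (Q <= n)%N -> x n = 0 by rewrite geq_max => /andP[h _]; exact: hN.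
have hy n : (Q <= n)%N -> y n = 0 by rewrite geq_max => /andP[_ h]; exact: hN'.
have hs n : (Q <= n)%N -> (c *: x + y) n = 0.
  by move=> h; rewrite dsum_val_lin hx // hy // scaler0 addr0.
rewrite (dliftE lf hx) (dliftE lf hy) (dliftE lf hs) scaler_sumr -big_split /=.
by apply: eq_bigr => n _; exact: (lf n c (x n) (y n)).
Qed.

Lemma dlift_inj (V : lmodType K) (f : forall n, T n -> V) n (t : T n) :
  (forall n, linear (f n)) -> dlift f (dinj t) = f n t.
Proof.
move=> lf; rewrite (@dliftE _ f _ n.+1) //; last first.
  by move=> k h; rewrite dinj_neq // neq_ltn h.
rewrite big_ord_recr /= inj_fun_eq big1 ?add0r // => k _.
by rewrite inj_fun_neq ?(lin0 (lf k)) // neq_ltn ltn_ord orbT.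
Qed.

Lemma dsum_sumE (x : dsum) N : (forall n, (N <= n)%N -> x n = 0) ->
  x = \sum_(n < N) dinj (x n).
Proof.
move=> hN; apply: dsumP => k; rewrite (lin_sum (dsum_val_lin k)).
have [kN|kN] := ltnP k N; last first.
  rewrite hN // big1 // => i _; rewrite dinj_neq //.
  by rewrite neq_ltn (leq_trans (ltn_ord i) kN).
rewrite (bigD1 (Ordinal kN)) //= inj_fun_eq big1 ?addr0 // => i ik.
by rewrite inj_fun_neq.
Qed.

Lemma dsum_ind (P : dsum -> Prop) :
  (forall x y, P x -> P y -> P (x + y)) -> (forall n (t : T n), P (dinj t)) ->
  forall x, P x.
Proof.
move=> PD Pi x; have [N hN] := dsum_fin x; rewrite (dsum_sumE hN).
elim/big_ind: _ => //; by rewrite -(lin0 (@dinj_lin 0)).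
Qed.

End DirectSum.

Section TensorAlgebra.
Variables (K : fieldType) (A : ualg K) (M : bimod A A).

Definition talg_mod : lmodType K := dsum (fun n => tpow M n : lmodType K).

Definition tinj n (t : tpow M n) : talg_mod :=
  @dinj K (fun n => tpow M n : lmodType K) n t.

Lemma tinj_lin n : linear (@tinj n). Proof. exact: dinj_lin. Qed.

Lemma talg_ind (P : talg_mod -> Prop) :
  (forall x y, P x -> P y -> P (x + y)) -> (forall n (t : tpow M n), P (tinj t)) ->
  forall x, P x.
Proof. exact: dsum_ind. Qed.

Definition talg_lift (V : lmodType K) (f : forall n, tpow M n -> V) : talg_mod -> V :=
  dlift f.

Lemma talg_lift_lin (V : lmodType K) (f : forall n, tpow M n -> V) :
  (forall n, linear (f n)) -> linear (talg_lift f).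
Proof. exact: dlift_lin. Qed.
Lemma talg_lift_inj (V : lmodType K) (f : forall n, tpow M n -> V) n (t : tpow M n) :
  (forall n, linear (f n)) -> talg_lift f (tinj t) = f n t.
Proof. exact: dlift_inj. Qed.

Definition talg_one : talg_mod := @tinj 0 (1 : A).
Definition talg_mul (x y : talg_mod) : talg_mod :=
  talg_lift (fun m s => talg_lift (fun n t => tinj (tmul s t)) y) x.

Let in_lin m (s : tpow M m) n : linear (fun t : tpow M n => tinj (tmul s t)).
Proof. exact: (lin_comp (tmul_linr s) (@tinj_lin _)). Qed.

Let in_linl y m :
  linear (fun s : tpow M m => talg_lift (fun n t => tinj (tmul s t)) y).
Proof.
move=> c s s'; elim/talg_ind: y => [x y IH IH'|n t].
  rewrite !(linD (talg_lift_lin (in_lin _))) IH IH' scalerDr.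
  by rewrite addrACA.
by rewrite !(talg_lift_inj _ (in_lin _)) (tmul_linl t) tinj_lin.
Qed.

Lemma talg_mul_linl y : linear (talg_mul^~ y).
Proof. exact: (talg_lift_lin (in_linl y)). Qed.

Lemma talg_mul_linr x : linear (talg_mul x).
Proof.
elim/talg_ind: x => [x x' IH IH' c y y'|m s].
  by rewrite !(linD (talg_mul_linl _)) IH IH' scalerDr addrACA.
move=> c y y'; rewrite /talg_mul !(talg_lift_inj _ (in_linl _)).
exact: (talg_lift_lin (in_lin s)).
Qed.

Lemma talg_mul_inj m n (s : tpow M m) (t : tpow M n) :
  talg_mul (tinj s) (tinj t) = tinj (tmul s t).
Proof. by rewrite /talg_mul (talg_lift_inj _ (in_linl _)) (talg_lift_inj _ (in_lin _)). Qed.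

Let consT (w : M) : talg_mod -> talg_mod :=
  talg_lift (fun n (t : tpow M n) => @tinj n.+1 (tcons w t)).
Let cons_lin w n : linear (fun t : tpow M n => @tinj n.+1 (tcons w t)).
Proof. exact: (lin_comp (@tcons_linr _ _ _ _ w) (@tinj_lin _)). Qed.
Let consTE w n (t : tpow M n) : @tinj n.+1 (tcons w t) = consT w (tinj t).
Proof. by rewrite /consT talg_lift_inj //; exact: cons_lin. Qed.

Lemma tinj_mulA m n p (x : tpow M m) (y : tpow M n) (z : tpow M p) :
  tinj (tmul x (tmul y z)) = tinj (tmul (tmul x y) z).
Proof.
elim: m x => [|m IH] x; first by rewrite /= -tmul_lact.
elim/tpow_ind: x => [|w t u IHu].
  by rewrite !(lin0 (tmul_linl _)) !(lin0 (@tinj_lin _)).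
rewrite !(linD (tmul_linl _)) !(linD (@tinj_lin _)) IHu.
congr (_ + _); rewrite !tmul_cons.
by rewrite (consTE w (tmul t (tmul y z))) IH -consTE.
Qed.

Lemma talg_mulA : associative talg_mul.
Proof.
move=> x y z; elim/talg_ind: x => [x x' IH IH'|m s].
  by rewrite !(linD (talg_mul_linl _)) IH IH'.
elim/talg_ind: y => [y y' IH IH'|n t].
  by rewrite (linD (talg_mul_linl _)) !(linD (talg_mul_linr _)) (linD (talg_mul_linl _)) IH IH'.
elim/talg_ind: z => [z z' IH IH'|p u].
  by rewrite !(linD (talg_mul_linr _)) IH IH'.
by rewrite !talg_mul_inj tinj_mulA.
Qed.

Lemma talg_mul1 : left_id talg_one talg_mul.
Proof.
move=> x; elim/talg_ind: x => [x y IH IH'|n t]; first by rewrite (linD (talg_mul_linr _)) IH IH'.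
by rewrite talg_mul_inj /= lact1.
Qed.

Let tinj_mul1 m (x : tpow M m) : tinj (tmul x (1 : tpow M 0)) = tinj x.
Proof.
elim: m x => [|m IH] x; first by rewrite /= mulr1.
elim/tpow_ind: x => [|w t u IHu]; first by rewrite (lin0 (tmul_linl _)) !(lin0 (@tinj_lin _)).
by rewrite (linD (tmul_linl _)) !(linD (@tinj_lin _)) IHu tmul_cons (consTE w (tmul t (1 : tpow M 0))) IH -consTE.
Qed.

Lemma talg_mulr1 : right_id talg_one talg_mul.
Proof.
move=> x; elim/talg_ind: x => [x y IH IH'|n t]; first by rewrite (linD (talg_mul_linl _)) IH IH'.
by rewrite talg_mul_inj tinj_mul1.
Qed.

Definition talg : ualg K :=
  UAlg talg_mulA talg_mul1 talg_mulr1 talg_mul_linl talg_mul_linr.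

Definition tin n (t : tpow M n) : talg := tinj t.

Lemma tin_lin n : linear (@tin n). Proof. exact: tinj_lin. Qed.
Lemma tinM m n (s : tpow M m) (t : tpow M n) : tin s * tin t = tin (tmul s t).
Proof. exact: talg_mul_inj. Qed.
Lemma tin1 : @tin 0 (1 : A) = 1. Proof. by []. Qed.
Lemma tin_cons n w (t : tpow M n) : @tin n.+1 (tcons w t) = @tin 1 w * tin t.
Proof. by rewrite tinM tmul1l. Qed.
Lemma tin_lact n a (t : tpow M n) : tin (lact a t) = @tin 0 a * tin t.
Proof. by rewrite tinM. Qed.
Lemma tin_ract1 w a : @tin 1 (ract w a) = @tin 1 w * @tin 0 a.
Proof. by rewrite tinM tmul1l. Qed.

Lemma talg_lin_ind (P : talg -> Prop) :
  (forall x y, P x -> P y -> P (x + y)) -> (forall n (t : tpow M n), P (tin t)) ->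
  forall x, P x.
Proof. exact: dsum_ind. Qed.

End TensorAlgebra.

Section TensorComponents.
Variables (K : fieldType) (A : ualg K) (M : bimod A A).

Definition tcomp n (x : talg M) : tpow M n := dsum_val x n.

Lemma tcomp_lin n : linear (@tcomp n). Proof. by []. Qed.
Lemma tcomp_eq n (t : tpow M n) : tcomp n (tin t) = t.
Proof. exact: dinj_eq. Qed.
Lemma tcomp_neq n (t : tpow M n) k : n != k -> tcomp k (tin t) = 0.
Proof. exact: dinj_neq. Qed.
Lemma tcomp_sum (x : talg M) : exists N, x = \sum_(n < N) tin (tcomp n x).
Proof. by have [N hN] := dsum_fin x; exists N; exact: dsum_sumE. Qed.

End TensorComponents.

(* The universal differential calculus [Omega_u(A)]: the tensor algebra of
   [Om1 A] with the differential extending [du]. *)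
Section UniversalCalculus.
Variables (K : fieldType) (A : ualg K).
Local Notation M := (Om1 A).
Local Notation "'T" := (talg (Om1 A)).
Local Notation "v ** w" := (@tcons K A M 1 v w) (at level 40).

(* On [A (x)_K A], [x (x) y |-> d x (x) d y]. Its restriction to [Om1 A] is the
   differential in degree 1, since an element [sum x_i (x) y_i] of [Om1 A] is
   equal to [sum x_i d y_i] (see [AxA_duE]). *)
Definition dAxA : AxA A -> tpow M 2 :=
  @tlift K A _ A (lreg_bimod A) (rreg_bimod A) (tpow M 2)
    (fun x y : A => du x ** du y).
Definition du1 (w : M) : tpow M 2 := dAxA (Om1_val w).

(* [d a = du a] in degree 0 and [d (w (x) t) = d w (x) t - w (x) d t]. *)
Fixpoint dpow (n : nat) : tpow M n -> tpow M n.+1 :=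
  match n return tpow M n -> tpow M n.+1 with
  | 0 => fun a => du (a : A)
  | n'.+1 => @tplift K A M n' (tpow M n'.+2)
               (fun w t => @tmul K A M 2 (du1 w) n' t - tcons w (@dpow n' t))
  end.

Definition dU (x : 'T) : 'T := talg_lift (fun n t => tinj (@dpow n t)) x.

Let tmkl (w : M) : linear (fun v : M => v ** w). Proof. exact: (@tcons_linl K A M 1 w). Qed.
Let tmkr (w : M) : linear (fun v : M => w ** v). Proof. exact: (@tcons_linr K A M 1 w). Qed.

Lemma dAxA_bal : @balanced K A _ A (lreg_bimod A) (rreg_bimod A) (tpow M 2)
  (fun x y : A => du x ** du y).
Proof.
split=> [y|x|x c y].
- exact: (lin_comp (@du_lin K A) (tmkl (du y))).
- exact: (lin_comp (@du_lin K A) (tmkr (du x))).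
- change (du ((c : K) *: x : A) ** du y = du x ** du ((c : K) *: y : A)).
  by rewrite !(linZ (@du_lin K A)) (linZ (tmkl _)) (linZ (tmkr _)).
Qed.

Lemma dAxA_lin : linear dAxA. Proof. exact: (tlift_lin dAxA_bal). Qed.
Lemma dAxAE x y : dAxA (atens x y) = du x ** du y.
Proof. exact: (tlift_tmk _ _ dAxA_bal). Qed.

(* [x (x) y |-> x d y] *)
Definition AxA_du : AxA A -> M :=
  @tlift K A _ A (lreg_bimod A) (rreg_bimod A) M (fun x y : A => lact x (du y)).

Let AxA_du_bal : @balanced K A _ A (lreg_bimod A) (rreg_bimod A) M
  (fun x y : A => lact x (du y)).
Proof.
split=> [y|x|x c y].
- exact: lact_linl.
- exact: (lin_comp (@du_lin K A) (lact_linr x)).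
- change (lact ((c : K) *: x : A) (du y) = lact x (du ((c : K) *: y : A))).
  by rewrite (linZ (@du_lin K A)) (linZ (lact_linr _)) (linZ (lact_linl (du y))).
Qed.

Lemma AxA_du_lin : linear AxA_du. Proof. exact: (tlift_lin AxA_du_bal). Qed.
Lemma AxA_du_atens x y : AxA_du (atens x y) = lact x (du y).
Proof. exact: (tlift_tmk _ _ AxA_du_bal). Qed.

Lemma AxA_duE (w : M) : w = AxA_du (Om1_val w).
Proof.
apply: Om1_inj; have h (t : AxA A) : Om1_val (AxA_du t) = t - atens (mulmap t) 1.
  elim/AxA_ind: t => [|x y t IH].
    rewrite (lin0 AxA_du_lin) (lin0 (@Om1_val_lin K A)) (lin0 (@mulmap_lin K A)).
    by rewrite (lin0 (atens_linl 1)) subrr.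
  rewrite (linD AxA_du_lin) (linD (@Om1_val_lin K A)) IH AxA_du_atens.
  rewrite (linD (@mulmap_lin K A)) (linD (atens_linl 1)) mulmapE.
  rewrite Om1_val_lact Om1_val_du (linB (lact_linr x)) !lact_atens mulr1.
  by rewrite opprD addrACA.
by rewrite h Om1P (lin0 (atens_linl 1)) subr0.
Qed.

Lemma du1_lin : linear du1.
Proof. exact: (lin_comp (@Om1_val_lin K A) dAxA_lin). Qed.

Lemma du1_lact a w : du1 (lact a w) = lact a (du1 w) + du a ** w.
Proof.
rewrite /du1 Om1_val_lact [in _ ** w](AxA_duE w).
elim/AxA_ind: (Om1_val w) => [|x y t IH].
  rewrite (lin0 (lact_linr a)) (lin0 dAxA_lin) (lin0 (lact_linr a)).
  by rewrite (lin0 AxA_du_lin) (lin0 (tmkr _)) addr0.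
rewrite (linD (lact_linr a)) !(linD dAxA_lin) IH (linD (lact_linr a)) (linD AxA_du_lin).
rewrite (linD (tmkr _)) lact_atens !dAxAE AxA_du_atens duM (linD (tmkl _)).
rewrite -(@tcons_ract K A M 1) (@lact_tcons K A M 1).
by rewrite [X in X + _ = _]addrC addrACA.
Qed.

Lemma du1_ract w a : du1 (ract w a) = ract (du1 w) a - w ** du a.
Proof.
suff h t : dAxA (ract t a) + AxA_du t ** du a
           = ract (dAxA t) a + du (mulmap t) ** du a.
  have := h (Om1_val w); rewrite -Om1_val_ract -/(du1 _) -AxA_duE Om1P.
  by rewrite (lin0 (@du_lin K A)) (lin0 (tmkl _)) addr0 => <-; rewrite addrK.
elim/AxA_ind: t => [|x y t IH].
  rewrite (lin0 (ract_linl a)) (lin0 dAxA_lin) (lin0 (ract_linl a)).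
  by rewrite (lin0 AxA_du_lin) (lin0 (@mulmap_lin K A)) (lin0 (@du_lin K A)).
rewrite (linD (ract_linl a)) !(linD dAxA_lin) (linD (ract_linl a)) (linD AxA_du_lin).
rewrite (linD (@mulmap_lin K A)) (linD (@du_lin K A)) !(linD (tmkl (du a))).
rewrite addrACA IH [RHS]addrACA; congr (_ + _).
rewrite ract_atens !dAxAE AxA_du_atens mulmapE !duM (linD (tmkl _)) (linD (tmkr _)).
by rewrite (@tcons_ract K A M 1) (@ract_tcons K A M 1) addrA.
Qed.

Let dpow_bal n : linear (@dpow n) ->
  (forall a (t : tpow M n), dpow (lact a t) = tcons (du a) t + lact a (dpow t)) ->
  @balanced K A A A M (tpow M n) (tpow M n.+2)
    (fun w t => @tmul K A M 2 (du1 w) n t - tcons w (dpow t)).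
Proof.
move=> dl da; split=> [t|w|w b t].
- move=> c w w'; rewrite du1_lin (tmul_linl t) (tcons_linl (dpow t)) scalerBr.
  by rewrite opprD addrACA.
- move=> c t t'; rewrite dl (tmul_linr (du1 w)) (tcons_linr w) scalerBr.
  by rewrite opprD addrACA.
rewrite du1_ract (linB (tmul_linl t)) tmul_ract da tcons_ract.
rewrite (linD (tcons_linr w)) opprD addrA; congr (_ - _ - _).
by rewrite (@tmul_cons K A M 1 n w (du b) t) tmul1l.
Qed.

Lemma dpow_props n : linear (@dpow n) /\
  forall a (t : tpow M n), dpow (lact a t) = tcons (du a) t + lact a (dpow t).
Proof.
elim: n => [|n [IHl IHa]]; first by split=> [|a t]; [exact: du_lin | exact: duM].
have bal := dpow_bal IHl IHa.
have lin : linear (@dpow n.+1) by exact: (tplift_lin bal).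
have dE w (t : tpow M n) : @dpow n.+1 (tcons w t) =
    @tmul K A M 2 (du1 w) n t - tcons w (dpow t) by exact: (tplift_cons _ _ bal).
split=> // a t; elim/tpow_ind: t => [|w t u IHu].
  rewrite (lin0 (lact_linr a)) (lin0 lin) (lin0 (tcons_linr _)) (lin0 (lact_linr a)).
  by rewrite addr0.
rewrite (linD (lact_linr a)) !(linD lin) IHu (linD (lact_linr a)) (linD (tcons_linr _)).
rewrite [RHS]addrACA; congr (_ + _).
rewrite lact_tcons !dE du1_lact (linD (tmul_linl t)) tmul_lact (linB (lact_linr a)).
rewrite lact_tcons (@tmul_cons K A M 1 n (du a) w t) tmul1l.
by rewrite -addrA addrCA.
Qed.

Lemma dpow_lin n : linear (@dpow n). Proof. by have [] := dpow_props n. Qed.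

Let dU_inl n : linear (fun t : tpow M n => tinj (dpow t)).
Proof. exact: (lin_comp (@dpow_lin n) (@tinj_lin _ _ _ _)). Qed.

Lemma dU_lin : linear dU. Proof. exact: (talg_lift_lin dU_inl). Qed.
Lemma dU_tin n (t : tpow M n) : dU (tin t) = tin (dpow t).
Proof. exact: (talg_lift_inj _ dU_inl). Qed.

Lemma dU_0 (a : A) : dU (@tin K A M 0 a) = @tin K A M 1 (du a).
Proof. exact: dU_tin. Qed.

Lemma dpow_cons n w (t : tpow M n) : @dpow n.+1 (tcons w t) =
  @tmul K A M 2 (du1 w) n t - tcons w (dpow t).
Proof.
by have [h h'] := dpow_props n; exact: (tplift_cons _ _ (dpow_bal h h')).
Qed.

Lemma dU_lact (a : A) (x : 'T) :
  dU (@tin K A M 0 a * x) = @tin K A M 1 (du a) * x + @tin K A M 0 a * dU x.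
Proof.
elim/talg_lin_ind: x => [x y IH IH'|n t].
  by rewrite mulrDr !(linD dU_lin) !mulrDr IH IH' addrACA.
rewrite tinM dU_tin /= (dpow_props n).2 (linD (@tin_lin _ _ _ _)).
by rewrite tin_cons dU_tin tin_lact.
Qed.

Lemma dU_cons (w : M) (x : 'T) :
  dU (@tin K A M 1 w * x) = @tin K A M 2 (du1 w) * x - @tin K A M 1 w * dU x.
Proof.
elim/talg_lin_ind: x => [x y IH IH'|n t].
  by rewrite mulrDr !(linD dU_lin) !mulrDr IH IH' opprD addrACA.
by rewrite -tin_cons !dU_tin dpow_cons (linB (@tin_lin _ _ _ _)) tinM -tin_cons.
Qed.

Lemma dU_leibniz n (t : tpow M n) (y : 'T) :
  dU (tin t * y) = dU (tin t) * y + (-1) ^+ n * tin t * dU y.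
Proof.
elim: n t => [|n IH] t; first by rewrite dU_lact dU_0 mul1r.
elim/tpow_ind: t => [|w t u IHu].
  by rewrite (lin0 (@tin_lin _ _ _ _)) mulr0 !mul0r (lin0 dU_lin) mul0r addr0.
rewrite (linD (@tin_lin _ _ _ _)) mulrDl !(linD dU_lin) IHu mulrDl mulrDr mulrDl.
rewrite [RHS]addrACA; congr (_ + _).
rewrite tin_cons -mulrA !dU_cons IH mulrBl mulrDr opprD addrA !mulrA; congr (_ + _).
rewrite exprS mulN1r !mulNr; congr (- (_ * _ * _)); exact: commr_sign.
Qed.

Lemma du_1 : du (1 : A) = 0.
Proof. by apply: Om1_inj; rewrite Om1_val_du subrr (lin0 (@Om1_val_lin K A)). Qed.

Lemma du1_du (a : A) : du1 (du a) = 0.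
Proof.
rewrite /du1 Om1_val_du (linB dAxA_lin) !dAxAE du_1.
by rewrite (lin0 (tmkl _)) (lin0 (tmkr _)) subrr.
Qed.

Let dU_du1 (w : M) : dU (@tin K A M 2 (du1 w)) = 0.
Proof.
rewrite /du1; elim/AxA_ind: (Om1_val w) => [|x y t IH].
  by rewrite (lin0 dAxA_lin) (lin0 (@tin_lin _ _ _ _)) (lin0 dU_lin).
rewrite (linD dAxA_lin) (linD (@tin_lin _ _ _ _)) (linD dU_lin) IH addr0 dAxAE.
rewrite tin_cons dU_cons -dU_0 -dU_0 !dU_0 du1_du dU_tin.
have -> : @dpow 1 (du y) = 0.
  have -> : du y = @tcons K A M 0 (du y) (1 : A) by exact: esym (ract1 (du y)).
  rewrite dpow_cons du1_du (lin0 (tmul_linl _)) [dpow _]du_1.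
  by rewrite (lin0 (tcons_linr _)) subrr.
by rewrite !(lin0 (@tin_lin _ _ _ _)) mul0r mulr0 subrr.
Qed.

Lemma dU_dU (x : 'T) : dU (dU x) = 0.
Proof.
elim/talg_lin_ind: x => [x y IH IH'|n t]; first by rewrite !(linD dU_lin) IH IH' addr0.
elim: n t => [|n IH] t.
  rewrite dU_0 -[@tin K A M 1 _]mulr1 dU_cons du1_du (lin0 (@tin_lin _ _ _ _)) mul0r.
  by rewrite -tin1 dU_0 du_1 (lin0 (@tin_lin _ _ _ _)) mulr0 subrr.
elim/tpow_ind: t => [|w t u IHu].
  by rewrite (lin0 (@tin_lin _ _ _ _)) !(lin0 dU_lin).
rewrite (linD (@tin_lin _ _ _ _)) !(linD dU_lin) IHu addr0 tin_cons dU_cons (linB dU_lin).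
rewrite dU_cons IH mulr0 subr0.
by rewrite dU_leibniz dU_du1 mul0r add0r sqrrN expr1n mul1r subrr.
Qed.

End UniversalCalculus.

Section UniversalDifferentialUnique.
Variables (K : fieldType) (A : ualg K).
Local Notation M := (Om1 A).

(* [dU] is the only differential of the tensor algebra of [Om1 A] extending [du]. *)
Lemma dU_unique (d : talg M -> talg M) :
  linear d ->
  (forall n (t : tpow M n) y, d (tin t * y) = d (tin t) * y + (-1) ^+ n * tin t * d y) ->
  (forall x, d (d x) = 0) ->
  (forall a : A, d (@tin K A M 0 a) = @tin K A M 1 (du a)) ->
  d =1 @dU K A.
Proof.
move=> dl dM dd d0 x; have d1 (w : M) : d (@tin K A M 1 w) = dU (@tin K A M 1 w).
  rewrite (AxA_duE w); elim/AxA_ind: (Om1_val w) => [|a b t IH].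
    by rewrite (lin0 (@AxA_du_lin K A)) (lin0 (@tin_lin _ _ _ _)) (lin0 dl) (lin0 (@dU_lin K A)).
  rewrite (linD (@AxA_du_lin K A)) (linD (@tin_lin _ _ _ _)) (linD dl) (linD (@dU_lin K A)) IH.
  congr (_ + _); rewrite AxA_du_atens (@tin_lact K A M 1) dM dU_leibniz d0 dU_0.
  have -> : d (@tin K A M 1 (du b)) = 0 by rewrite -d0 dd.
  by have -> : dU (@tin K A M 1 (du b)) = 0 by rewrite -dU_0 dU_dU.
elim/talg_lin_ind: x => [x y IH IH'|n t]; first by rewrite (linD dl) (linD (@dU_lin K A)) IH IH'.
elim: n t => [|n IH] t; first by rewrite d0 dU_0.
elim/tpow_ind: t => [|w t u IHu].
  by rewrite (lin0 (@tin_lin _ _ _ _)) (lin0 dl) (lin0 (@dU_lin K A)).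
rewrite (linD (@tin_lin _ _ _ _)) (linD dl) (linD (@dU_lin K A)) IHu.
by rewrite tin_cons dM dU_leibniz IH d1.
Qed.

End UniversalDifferentialUnique.

(* Graded differential algebras.  The underlying algebra is the direct sum of the
   subspaces [gdeg n], [n] in Z, of homogeneous elements of degree [n]. *)
Record gda (K : fieldType) := GDA {
  gda_alg :> ualg K;
  gdeg : int -> gda_alg -> Prop;
  gd : gda_alg -> gda_alg;
  gdeg_0 : forall n, gdeg n 0;
  gdeg_lin : forall n c x y, gdeg n x -> gdeg n y -> gdeg n (c *: x + y);
  gdeg_span : forall x, exists (s : seq int) (f : int -> gda_alg),
    (forall n, gdeg n (f n)) /\ x = \sum_(n <- s) f n;
  gdeg_free : forall (s : seq int) (f : int -> gda_alg),
    uniq s -> (forall n, gdeg n (f n)) -> \sum_(n <- s) f n = 0 ->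
    forall n, n \in s -> f n = 0;
  gdeg_1 : gdeg 0 1;
  gdeg_mul : forall m n x y, gdeg m x -> gdeg n y -> gdeg (m + n) (x * y);
  gd_lin : linear gd;
  gd_deg : forall n x, gdeg n x -> gdeg (n + 1) (gd x);
  gd_leibniz : forall m x y, gdeg m x ->
    gd (x * y) = gd x * y + (-1) ^+ absz m * (x * gd y);
  gd_sq : forall x, gd (gd x) = 0
}.

Arguments gdeg {K} G n x : rename.
Arguments gd {K} G x : rename.

Record is_gda_hom (K : fieldType) (G H : gda K) (F : G -> H) : Prop := {
  gda_hom_alg : is_alg_hom F;
  gda_hom_deg : forall n x, gdeg G n x -> gdeg H n (F x);
  gda_hom_d : forall x, F (gd G x) = gd H (F x)
}.

Section OmegaU.
Variables (K : fieldType) (A : ualg K).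
Local Notation M := (Om1 A).

Definition udeg (k : int) (x : talg M) : Prop :=
  match k with
  | Posz n => exists t : tpow M n, x = tin t
  | Negz _ => x = 0
  end.

Let deg0 k : udeg k 0.
Proof. by case: k => n //=; exists 0; rewrite (lin0 (@tin_lin _ _ _ _)). Qed.
Let deg_lin k (c : K) x y : udeg k x -> udeg k y -> udeg k (c *: x + y).
Proof.
case: k => n /=; last by move=> -> ->; rewrite scaler0 addr0.
by move=> [s ->] [t ->]; exists (c *: s + t); rewrite tin_lin.
Qed.

Let deg_comp k x n : udeg k x -> k != Posz n -> tcomp n x = 0.
Proof.
case: k => m /=; last by move=> ->.
by move=> [t ->] h; rewrite tcomp_neq //; apply: contraNneq h => ->.
Qed.

Let deg_sum (s : seq int) f n : uniq s -> (forall k, udeg k (f k)) ->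
  Posz n \in s -> tcomp n (\sum_(k <- s) f k) = tcomp n (f (Posz n)).
Proof.
move=> us hf ns; rewrite (lin_sum (@tcomp_lin K A M n)) (bigD1_seq (Posz n)) //=.
by rewrite big1 ?addr0 // => k kn; apply: deg_comp kn.
Qed.

Lemma udeg_sumE (s : seq int) f n : uniq s -> (forall k, udeg k (f k)) ->
  Posz n \in s -> f (Posz n) = tin (tcomp n (\sum_(k <- s) f k)).
Proof.
by move=> us hf ns; rewrite deg_sum //; have /= [t ->] := hf (Posz n); rewrite tcomp_eq.
Qed.

Let deg_span (x : talg M) : exists (s : seq int) (f : int -> talg M),
  (forall n, udeg n (f n)) /\ x = \sum_(n <- s) f n.
Proof.
have [N {1}->] := tcomp_sum x.
exists [seq Posz i | i <- iota 0 N], (fun k => if k is Posz n then tin (tcomp n x) else 0).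
split=> [[n|n] //=|]; first by exists (tcomp n x).
by rewrite big_map -[N in iota 0 N]subn0 -/(index_iota 0 N) big_mkord.
Qed.

Let deg_free (s : seq int) (f : int -> talg M) :
  uniq s -> (forall n, udeg n (f n)) -> \sum_(n <- s) f n = 0 ->
  forall n, n \in s -> f n = 0.
Proof.
move=> us hf s0 [n|n] ns; last exact: (hf (Negz n)).
by rewrite (udeg_sumE us hf ns) s0 (lin0 (@tin_lin _ _ _ _)).
Qed.

Let deg_1 : udeg 0 1. Proof. by exists (1 : A). Qed.

Let deg_mul m n x y : udeg m x -> udeg n y -> udeg (m + n) (x * y).
Proof.
case: m => m /=; last by move=> -> _; rewrite mul0r; exact: deg0.
case: n => n /=; last by move=> _ ->; rewrite mulr0; exact: deg0.
by move=> [s ->] [t ->]; rewrite tinM; exists (tmul s t).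
Qed.

Let deg_d n x : udeg n x -> udeg (n + 1) (dU x).
Proof.
case: n => n /=; last by move=> ->; rewrite (lin0 (@dU_lin K A)); exact: deg0.
by move=> [t ->]; rewrite dU_tin addn1; exists (dpow t).
Qed.

Let leib m (x y : talg M) : udeg m x ->
  dU (x * y) = dU x * y + (-1) ^+ absz m * (x * dU y).
Proof.
case: m => m /= => [[t ->]|->]; first by rewrite dU_leibniz mulrA.
by rewrite !(mul0r, lin0 (@dU_lin K A)) mulr0 addr0.
Qed.

Definition Omega_u : gda K :=
  GDA deg0 deg_lin deg_span deg_free deg_1 deg_mul (@dU_lin K A) deg_d leib (@dU_dU K A).

End OmegaU.

(* Two-sided ideals which are graded (they contain the homogeneous components of
   their elements) and stable under the differential; [qgda] is the quotient. *)
Record dg_ideal (K : fieldType) (G : gda K) := DGIdeal {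
  dgi :> G -> Prop;
  dgi_0 : dgi 0;
  dgi_D : forall x y, dgi x -> dgi y -> dgi (x + y);
  dgi_mull : forall x y, dgi y -> dgi (x * y);
  dgi_mulr : forall x y, dgi x -> dgi (x * y);
  dgi_graded : forall (s : seq int) (f : int -> G),
    uniq s -> (forall n, gdeg G n (f n)) -> dgi (\sum_(n <- s) f n) ->
    forall n, n \in s -> dgi (f n);
  dgi_d : forall x, dgi x -> dgi (gd G x)
}.

Section QuotientGDA.
Variables (K : fieldType) (G : gda K) (I : dg_ideal G).

Definition qgda_mod : lmodType K := qmod (I : (G : lmodType K) -> Prop).

Definition qgda_pi (x : G) : qgda_mod := qpi x.
Definition qgda_mul (p q : qgda_mod) : qgda_mod := qgda_pi ((qrepr p : G) * qrepr q).

Let piK (q : qgda_mod) : qgda_pi (qrepr q) = q. Proof. exact: qreprK. Qed.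
Let pi_lin : linear qgda_pi. Proof. exact: qpi_lin. Qed.

Let spanI x : in_span (I : (G : lmodType K) -> Prop) x <-> I x.
Proof.
split=> [|Ix].
  elim=> [|c g v Ig _ Iv]; first exact: dgi_0.
  by apply: dgi_D => //; rewrite -[g]mul1r -(linZ (mul_linl g)); exact: dgi_mull.
by rewrite -[x]addr0 -[x]scale1r; apply: in_spanZ => //; exact: in_span0.
Qed.

Lemma qgda_pi_eq (x y : G) : qgda_pi x = qgda_pi y <-> I (x - y).
Proof. by rewrite -spanI; exact: qpi_eq. Qed.

Lemma qgda_pi0 (x : G) : qgda_pi x = 0 <-> I x.
Proof. by rewrite -spanI; exact: qpi0P. Qed.

Let repr_pi (x : G) : I ((qrepr (qgda_pi x) : G) - x).
Proof. by apply/qgda_pi_eq; rewrite piK. Qed.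

Lemma qgda_piM (x y : G) : qgda_mul (qgda_pi x) (qgda_pi y) = qgda_pi (x * y).
Proof.
apply/qgda_pi_eq; rewrite -[_ * _](addrNK ((qrepr (qgda_pi x) : G) * y)) -mulrBr -addrA -mulrBl.
by apply: dgi_D; [apply: dgi_mull; exact: repr_pi | apply: dgi_mulr; exact: repr_pi].
Qed.

Let mulA : associative qgda_mul.
Proof. by move=> p q r; rewrite -[p]piK -[q]piK -[r]piK !qgda_piM mulrA. Qed.
Let mul1 : left_id (qgda_pi 1) qgda_mul.
Proof. by move=> p; rewrite -[p]piK qgda_piM mul1r. Qed.
Let mulr1' : right_id (qgda_pi 1) qgda_mul.
Proof. by move=> p; rewrite -[p]piK qgda_piM mulr1. Qed.
Let mull q : linear (qgda_mul^~ q).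
Proof.
move=> c p p'; rewrite -[p]piK -[p']piK -[q]piK -pi_lin !qgda_piM -pi_lin.
by rewrite (mul_linl (qrepr q : G)).
Qed.
Let mulr p : linear (qgda_mul p).
Proof.
move=> c q q'; rewrite -[p]piK -[q]piK -[q']piK -pi_lin !qgda_piM -pi_lin.
by rewrite (mul_linr (qrepr p : G)).
Qed.

Definition qgda_alg : ualg K := UAlg mulA mul1 mulr1' mull mulr.

Definition qgda_proj (x : G) : qgda_alg := qgda_pi x.

Lemma qgda_proj_lin : linear qgda_proj. Proof. exact: pi_lin. Qed.
Lemma qgda_projM : {morph qgda_proj : x y / x * y}.
Proof. by move=> x y; exact: esym (qgda_piM x y). Qed.
Lemma qgda_proj1 : qgda_proj 1 = 1. Proof. by []. Qed.
Lemma qgda_proj0 x : qgda_proj x = 0 <-> I x. Proof. exact: qgda_pi0. Qed.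
Lemma qgda_proj_surj (q : qgda_alg) : exists x, q = qgda_proj x.
Proof. by exists (qrepr q : G); rewrite /qgda_proj piK. Qed.

Definition qgda_deg (n : int) (q : qgda_alg) : Prop :=
  exists2 x : G, gdeg G n x & q = qgda_proj x.
Definition qgda_d (q : qgda_alg) : qgda_alg := qgda_proj (gd G (qrepr q)).

Lemma qgda_d_proj x : qgda_d (qgda_proj x) = qgda_proj (gd G x).
Proof.
apply/qgda_pi_eq; rewrite -(linB (@gd_lin K G)); apply: dgi_d; exact: repr_pi.
Qed.

Let deg0 n : qgda_deg n 0.
Proof. by exists 0; [exact: gdeg_0 | rewrite (lin0 qgda_proj_lin)]. Qed.
Let deg_lin n (c : K) x y : qgda_deg n x -> qgda_deg n y -> qgda_deg n (c *: x + y).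
Proof.
move=> [u hu ->] [v hv ->]; exists (c *: u + v); last by rewrite qgda_proj_lin.
exact: gdeg_lin.
Qed.
Let deg_span (q : qgda_alg) : exists (s : seq int) (f : int -> qgda_alg),
  (forall n, qgda_deg n (f n)) /\ q = \sum_(n <- s) f n.
Proof.
have [x ->] := qgda_proj_surj q; have [s [f [hf ->]]] := gdeg_span x.
exists s, (fun n => qgda_proj (f n)); split=> [n|]; first by exists (f n).
exact: (lin_sum qgda_proj_lin).
Qed.
Let deg_free (s : seq int) (f : int -> qgda_alg) :
  uniq s -> (forall n, qgda_deg n (f n)) -> \sum_(n <- s) f n = 0 ->
  forall n, n \in s -> f n = 0.
Proof.
move=> us hf s0.
pose g n : G := s2val (cid2 (hf n)).
have gE n : f n = qgda_proj (g n) by rewrite /g; case: cid2.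
have gdg n : gdeg G n (g n) by rewrite /g; case: cid2.
move=> n ns; rewrite gE; apply/qgda_proj0; apply: (dgi_graded us gdg) ns.
apply/qgda_proj0; rewrite -s0 (lin_sum qgda_proj_lin).
by apply: eq_bigr => k _; rewrite gE.
Qed.
Let deg_1 : qgda_deg 0 1. Proof. by exists 1 => //; exact: gdeg_1. Qed.
Let deg_mul m n x y : qgda_deg m x -> qgda_deg n y -> qgda_deg (m + n) (x * y).
Proof.
move=> [u hu ->] [v hv ->]; exists (u * v); last by rewrite qgda_projM.
exact: gdeg_mul.
Qed.
Let d_lin : linear qgda_d.
Proof.
move=> c p q; have [[x ->] [y ->]] := (qgda_proj_surj p, qgda_proj_surj q).
by rewrite -qgda_proj_lin !qgda_d_proj gd_lin qgda_proj_lin.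
Qed.
Let d_deg n x : qgda_deg n x -> qgda_deg (n + 1) (qgda_d x).
Proof. by move=> [u hu ->]; rewrite qgda_d_proj; exists (gd G u) => //; exact: gd_deg. Qed.
Let leib m x y : qgda_deg m x ->
  qgda_d (x * y) = qgda_d x * y + (-1) ^+ absz m * (x * qgda_d y).
Proof.
move=> [u hu ->]; have [v ->] := qgda_proj_surj y.
have sgn n w : qgda_proj ((-1) ^+ n * w) = (-1) ^+ n * qgda_proj w.
  elim: n => [|n IH]; first by rewrite !mul1r.
  by rewrite !exprS -!mulrA !mulN1r (linN qgda_proj_lin) IH.
rewrite -qgda_projM !qgda_d_proj (gd_leibniz v hu) (linD qgda_proj_lin).
by rewrite sgn !qgda_projM.
Qed.
Let d_sq x : qgda_d (qgda_d x) = 0.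
Proof.
by have [u ->] := qgda_proj_surj x; rewrite !qgda_d_proj gd_sq (lin0 qgda_proj_lin).
Qed.

Definition qgda : gda K :=
  GDA deg0 deg_lin deg_span deg_free deg_1 deg_mul d_lin d_deg leib d_sq.

End QuotientGDA.

Inductive subbimod_span (K : fieldType) (A B : ualg K) (M : bimod A B)
    (S : M -> Prop) : M -> Prop :=
| subbimod_gen m : S m -> subbimod_span S m
| subbimod_0 : subbimod_span S 0
| subbimod_D m n : subbimod_span S m -> subbimod_span S n -> subbimod_span S (m + n)
| subbimod_l a m : subbimod_span S m -> subbimod_span S (lact a m)
| subbimod_r m b : subbimod_span S m -> subbimod_span S (ract m b).

Inductive ideal_span (R : pzRingType) (S : R -> Prop) : R -> Prop :=
| ideal_gen x : S x -> ideal_span S x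
| ideal_0 : ideal_span S 0
| ideal_D x y : ideal_span S x -> ideal_span S y -> ideal_span S (x + y)
| ideal_l a x : ideal_span S x -> ideal_span S (a * x)
| ideal_r x a : ideal_span S x -> ideal_span S (x * a).

Section OmegaZ.
Variables (K : fieldType) (A : ualg K).
Local Notation M := (Om1 A).

(* The subbimodule [Z(A), Omega_u^1(A)]; in degree 1 [Omega_u A] is [Om1 A]. *)
Definition comm_center_Om1 : M -> Prop :=
  subbimod_span (fun m => exists (z : A) (w : M),
                   central z /\ m = lact z w - ract w z).

Definition IZ_gen (x : Omega_u A) : Prop :=
  exists2 w : M, comm_center_Om1 w &
    x = @tin K A M 1 w \/ x = gd (Omega_u A) (@tin K A M 1 w).

Definition IZ : Omega_u A -> Prop := ideal_span IZ_gen.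

(* Sums of homogeneous elements of [IZ] whose differential is in [IZ]; this is
   all of [IZ] (see [IZ_homP]). *)
Inductive IZ_hom : Omega_u A -> Prop :=
| IZ_hom_in n (t : tpow M n) : IZ (tin t) -> IZ (dU (tin t)) -> IZ_hom (tin t)
| IZ_hom_D x y : IZ_hom x -> IZ_hom y -> IZ_hom (x + y).

Let sgn_IZ n (x : Omega_u A) : IZ x -> IZ ((-1) ^+ n * x).
Proof. exact: ideal_l. Qed.

Let hom_l x y : IZ_hom y -> IZ_hom (x * y).
Proof.
move=> hy; elim/talg_lin_ind: x => [x x' IH IH'|m s].
  by rewrite mulrDl; exact: IZ_hom_D.
elim: hy => [n t It Idt|u v _ IHu _ IHv]; last by rewrite mulrDr; exact: IZ_hom_D.
rewrite tinM; apply: IZ_hom_in; rewrite -tinM; first exact: ideal_l.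
by rewrite dU_leibniz -mulrA; apply: ideal_D; [|apply: sgn_IZ]; exact: ideal_l.
Qed.

Let hom_r x y : IZ_hom x -> IZ_hom (x * y).
Proof.
move=> hx; elim/talg_lin_ind: y => [y y' IH IH'|m s].
  by rewrite mulrDr; exact: IZ_hom_D.
elim: hx => [n t It Idt|u v _ IHu _ IHv]; last by rewrite mulrDl; exact: IZ_hom_D.
rewrite tinM; apply: IZ_hom_in; rewrite -tinM; first exact: ideal_r.
by rewrite dU_leibniz -mulrA; apply: ideal_D; [|apply: sgn_IZ]; exact: ideal_r.
Qed.

Lemma IZ_homP x : IZ x <-> IZ_hom x.
Proof.
split; last by elim=> [//|u v _ Iu _ Iv]; exact: ideal_D.
elim=> [_ [w hw [->|->]]|||a u _ IH|u a _ IH].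
- by apply: IZ_hom_in; apply: ideal_gen; exists w => //; [left|right].
- rewrite [gd _ _]dU_tin; apply: IZ_hom_in; rewrite -dU_tin.
    by apply: ideal_gen; exists w => //; right.
  by rewrite dU_dU; exact: ideal_0.
- have -> : 0 = @tin K A M 0 0 by rewrite (lin0 (@tin_lin _ _ _ _)).
  by apply: IZ_hom_in; rewrite (lin0 (@tin_lin _ _ _ _)) ?(lin0 (@dU_lin K A)); exact: ideal_0.
- by move=> u v _ IHu _ IHv; exact: IZ_hom_D.
- exact: hom_l.
- exact: hom_r.
Qed.

Lemma IZ_d x : IZ x -> IZ (gd (Omega_u A) x).
Proof.
move=> /IZ_homP; elim=> [//|u v _ Iu _ Iv].
by rewrite (linD (@gd_lin K (Omega_u A))); exact: ideal_D.
Qed.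

Let IZ_comp x n : IZ x -> IZ (tin (tcomp n x)).
Proof.
move=> /IZ_homP; elim=> [m t It _|u v _ Iu _ Iv].
  have [<-|mn] := eqVneq m n; first by rewrite tcomp_eq.
  by rewrite tcomp_neq // (lin0 (@tin_lin _ _ _ _)); exact: ideal_0.
by rewrite (linD (@tcomp_lin K A M n)) (linD (@tin_lin _ _ _ _)); exact: ideal_D.
Qed.

Lemma IZ_graded (s : seq int) (f : int -> Omega_u A) :
  uniq s -> (forall n, gdeg (Omega_u A) n (f n)) -> IZ (\sum_(n <- s) f n) ->
  forall n, n \in s -> IZ (f n).
Proof.
move=> us hf Is [n|n] ns; last by have /= -> := hf (Negz n); exact: ideal_0.
by rewrite (udeg_sumE us hf ns); exact: IZ_comp.
Qed.

Definition IZ_ideal : dg_ideal (Omega_u A) :=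
  @DGIdeal K (Omega_u A) IZ (@ideal_0 _ _) (@ideal_D _ _)
    (fun x y => @ideal_l _ _ x y) (fun x y => @ideal_r _ _ x y) IZ_graded IZ_d.

Definition Omega_Z : gda K := qgda IZ_ideal.

(* The identification of [A] with [Omega_Z^0(A)]: an injective homomorphism whose
   image is the component of degree 0 (see [iota_Z_hom], [iota_Z_inj] and
   [iota_Z_deg0]). *)
Definition iota_Z (a : A) : Omega_Z := qgda_proj IZ_ideal (@tin K A M 0 a).

Lemma IZ_comp0 x : IZ x -> tcomp 0 x = 0.
Proof.
have t0M (u v : talg M) : tcomp 0 (u * v) = (tcomp 0 u : A) * (tcomp 0 v : A).
  elim/talg_lin_ind: u => [u u' IH IH'|m s].
    by rewrite mulrDl !(linD (@tcomp_lin K A M 0)) IH IH' -mulrDl.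
  elim/talg_lin_ind: v => [v v' IH IH'|n t].
    by rewrite mulrDr !(linD (@tcomp_lin K A M 0)) IH IH' -mulrDr.
  rewrite tinM; case: m s => [|m] s; last first.
    by rewrite [LHS]tcomp_neq // [tcomp 0 (tin s)]tcomp_neq //; exact: (esym (mul0r (_ : A))).
  case: n t => [|n] t; last first.
    by rewrite [LHS]tcomp_neq // [tcomp 0 (tin t)]tcomp_neq //; exact: (esym (mulr0 (_ : A))).
  by rewrite !tcomp_eq.
elim=> [_ [w _ [->|->]]|//|u v _ Iu _ Iv|a u _ Iu|u a _ Iu].
- by rewrite tcomp_neq.
- by rewrite [gd _ _]dU_tin tcomp_neq.
- by rewrite (linD (@tcomp_lin K A M 0)) Iu Iv addr0.
- by rewrite t0M Iu; exact: (mulr0 (_ : A)).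
- by rewrite t0M Iu; exact: (mul0r (_ : A)).
Qed.

Lemma iota_Z_hom : @is_alg_hom K A Omega_Z iota_Z.
Proof.
split; first exact: (lin_comp (@tin_lin _ _ _ 0) (qgda_proj_lin IZ_ideal)).
split=> [|a b] //; rewrite /iota_Z -[RHS](qgda_projM IZ_ideal).
by rewrite tinM.
Qed.

Lemma iota_Z_inj : injective iota_Z.
Proof.
move=> a b /qgda_pi_eq; rewrite -(linB (@tin_lin _ _ _ _)) => /IZ_comp0.
by rewrite tcomp_eq => /eqP; rewrite subr_eq0 => /eqP.
Qed.

Lemma iota_Z_deg0 (q : Omega_Z) : gdeg Omega_Z 0 q <-> exists a, q = iota_Z a.
Proof.
split=> [[x [a ->] ->]|[a ->]]; first by exists a.
by exists (@tin K A M 0 a) => //; exists a.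
Qed.

End OmegaZ.

(* Main.v *)
Require Import Defs.
From mathcomp Require Import all_boot all_algebra.
From mathcomp Require Import boolp reals complex.

Set Implicit Arguments.
Unset Strict Implicit.
Unset Printing Implicit Defensive.

Import GRing.Theory.

Local Open Scope ring_scope.

(** The calculus [Omega_Z A] is itself universal ([Omega_Z_universal]): an
    algebra homomorphism [psi] from [A] to the degree 0 part of a graded
    differential algebra [G] extends uniquely to [Omega_Z A] as soon as [psi z]
    commutes with every [d (psi a)], for [z] central in [A].  The functoriality
    of [Omega_Z] is the case [G = Omega_Z B], [psi = iota_Z \o phi]: when
    [phi z] is central in [B], the commutator of [phi z] with [d (phi a)] is
    one of the generators of the ideal [IZ] of [B] ([iota_Z_comm_d]).

    The universal property comes from the one of [Omega_u A].  The elements [a], [d a] ([a] in [A]) generate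
    [Omega_u A] as an algebra, whence the uniqueness ([Omega_u_hom_unique]).
    For the existence, [x (x) y |-> psi x * d (psi y)] restricts to a bimodule
    map from [Om1 A], the kernel of the product, to the degree 1 part of [G]
    ([Om1_lift_ract]); it extends to the tensor algebra as an algebra
    homomorphism [Omega_u_hom psi] ([talg_hom_alg]), and this one commutes with
    the differentials because it does so in degrees 0 and 1 and both sides obey
    the Leibniz rule ([Omega_u_hom_d]).

    Finally [psi z] commutes with the image of [Om1 A], which is spanned by the
    products [psi x * d (psi y)] ([Om1_lift_center]); so [Omega_u_hom psi] kills
    the commutators of central elements with 1-forms.  Being a homomorphism of
    graded differential algebras, it kills the ideal [IZ] which they generate
    together with their differentials ([Omega_u_hom_IZ]), and it factors
    through the quotient [Omega_Z A]. *)

(** * Homomorphisms out of a tensor algebra *)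

Section TensorAlgebraUniversal.
Variables (K : fieldType) (A : ualg K) (M : bimod A A) (C : ualg K).
Variables (psi : A -> C) (f : M -> C).
Hypothesis psi_hom : is_alg_hom psi.
Hypothesis f_lin : linear f.
Hypothesis f_lact : forall a m, f (lact a m) = psi a * f m.
Hypothesis f_ract : forall m a, f (ract m a) = f m * psi a.

Fixpoint tpow_lift (n : nat) : tpow M n -> C :=
  match n return tpow M n -> C with
  | 0 => fun a => psi (a : A)
  | n'.+1 => @tplift K A M n' (ualg_sort C) (fun w t => f w * @tpow_lift n' t)
  end.

Lemma tpow_lift_bal n : linear (@tpow_lift n) ->
    (forall a (t : tpow M n), tpow_lift (lact a t) = psi a * tpow_lift t) ->
  @balanced K A A A M (tpow M n) (ualg_sort C) (fun w t => f w * tpow_lift t).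
Proof.
move=> hl ha; split=> [t|w|w a t].
- exact: (lin_comp f_lin (mul_linl (tpow_lift t))).
- exact: (lin_comp hl (mul_linr (f w))).
- by rewrite f_ract ha mulrA.
Qed.

(** Linearity and left [A]-linearity have to be proved together, by induction on
    [n]: both are needed for the map defining [tpow_lift] on the next tensor
    power to be balanced, hence for [tpow_lift] to be meaningful there. *)
Lemma tpow_lift_props n : linear (@tpow_lift n) /\
  forall a (t : tpow M n), tpow_lift (lact a t) = psi a * tpow_lift t.
Proof.
elim: n => [|n [IHl IHa]].
  by split=> [|a t]; [exact: psi_hom.1 | exact: psi_hom.2.2].
have bal := tpow_lift_bal IHl IHa.
have lin : linear (@tpow_lift n.+1) by exact: (tplift_lin bal).
have consE w (t : tpow M n) : @tpow_lift n.+1 (tcons w t) = f w * tpow_lift t.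
  exact: (tplift_cons _ _ bal).
split=> // a t; elim/tpow_ind: t => [|w t u IHu].
  by rewrite (lin0 (lact_linr a)) (lin0 lin) mulr0.
rewrite (linD (lact_linr a)) !(linD lin) IHu mulrDr; congr (_ + _).
by rewrite lact_tcons !consE f_lact mulrA.
Qed.

Lemma tpow_lift_lin n : linear (@tpow_lift n).
Proof. by have [] := tpow_lift_props n. Qed.

Lemma tpow_lift_lact n a (t : tpow M n) :
  tpow_lift (lact a t) = psi a * tpow_lift t.
Proof. by have [_] := tpow_lift_props n. Qed.

Lemma tpow_lift_cons n w (t : tpow M n) :
  @tpow_lift n.+1 (tcons w t) = f w * tpow_lift t.
Proof.
exact: (tplift_cons _ _ (tpow_lift_bal (@tpow_lift_lin n) (@tpow_lift_lact n))).
Qed.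

Lemma tpow_liftM m n (s : tpow M m) (t : tpow M n) :
  tpow_lift (tmul s t) = tpow_lift s * tpow_lift t.
Proof.
elim: m s => [|m IH] s; first exact: tpow_lift_lact.
elim/tpow_ind: s => [|w s u IHu].
  by rewrite (lin0 (tmul_linl t)) !(lin0 (@tpow_lift_lin _)) mul0r.
rewrite (linD (tmul_linl t)) !(linD (@tpow_lift_lin _)) IHu mulrDl.
by rewrite tmul_cons !tpow_lift_cons IH mulrA.
Qed.

Definition talg_hom (x : talg M) : C :=
  @talg_lift K A M (ualg_sort C) tpow_lift x.

Lemma talg_hom_lin : linear talg_hom.
Proof. exact: (talg_lift_lin tpow_lift_lin). Qed.

Lemma talg_hom_tin n (t : tpow M n) : talg_hom (tin t) = tpow_lift t.
Proof. exact: (talg_lift_inj _ tpow_lift_lin). Qed.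

Lemma talg_hom_alg : @is_alg_hom K (talg M) C talg_hom.
Proof.
split; first exact: talg_hom_lin.
split=> [|x y]; first by rewrite -tin1 talg_hom_tin; exact: psi_hom.2.1.
elim/talg_lin_ind: x => [x x' IH IH'|m s].
  by rewrite mulrDl !(linD talg_hom_lin) IH IH' mulrDl.
elim/talg_lin_ind: y => [y y' IH IH'|n t].
  by rewrite mulrDr !(linD talg_hom_lin) IH IH' mulrDr.
by rewrite tinM !talg_hom_tin tpow_liftM.
Qed.

Lemma talg_hom1 w : talg_hom (@tin K A M 1 w) = f w.
Proof.
have -> : w = @tcons K A M 0 w (1 : A) by rewrite /= ract1.
by rewrite talg_hom_tin tpow_lift_cons f_ract psi_hom.2.1 mulr1 [tpow_lift _]psi_hom.2.1 mulr1.
Qed.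

End TensorAlgebraUniversal.

(** * Elementary facts on graded differential algebras *)

Section GradedDifferentialAlgebras.
Variables (K : fieldType) (G : gda K).

Lemma gdegD n x y : gdeg G n x -> gdeg G n y -> gdeg G n (x + y).
Proof. by move=> hx hy; rewrite -[x]scale1r; exact: gdeg_lin. Qed.

Lemma gd_1 : gd G 1 = 0.
Proof.
have := gd_leibniz 1 (gdeg_1 G); rewrite !mulr1 !mul1r.
by move=> /eqP; rewrite -subr_eq0 opprD addrA subrr sub0r oppr_eq0 => /eqP.
Qed.

Lemma gd_leibniz0 x y : gdeg G 0 x -> gd G (x * y) = gd G x * y + x * gd G y.
Proof. by move=> hx; rewrite (gd_leibniz y hx) mul1r. Qed.

End GradedDifferentialAlgebras.

(** * The universal property of the universal calculus *)

Section OmegaUUniversal.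
Variables (K : fieldType) (A : ualg K) (G : gda K) (psi : A -> G).
Hypothesis psi_hom : is_alg_hom psi.
Hypothesis psi_deg : forall a, gdeg G 0 (psi a).

Let psi_lin : linear psi. Proof. exact: psi_hom.1. Qed.
Let psiM a b : psi (a * b) = psi a * psi b. Proof. exact: psi_hom.2.2. Qed.

Let dpsi_lin : linear (fun a => gd G (psi a)).
Proof. exact: (lin_comp psi_lin (@gd_lin K G)). Qed.

Definition AxA_lift : AxA A -> G :=
  @tlift K A _ A (lreg_bimod A) (rreg_bimod A) (ualg_sort G)
    (fun x y : A => psi x * gd G (psi y)).

Lemma AxA_lift_bal :
  @balanced K A _ A (lreg_bimod A) (rreg_bimod A) (ualg_sort G)
    (fun x y : A => psi x * gd G (psi y)).
Proof.
split=> [y|x|x c y].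
- exact: (lin_comp psi_lin (mul_linl (gd G (psi y)))).
- exact: (lin_comp dpsi_lin (mul_linr (psi x))).
- change (psi ((c : K) *: x : A) * gd G (psi y)
          = psi x * gd G (psi ((c : K) *: y : A))).
  by rewrite (linZ psi_lin) (linZ dpsi_lin) (linZ (mul_linl _)) (linZ (mul_linr _)).
Qed.

Lemma AxA_lift_lin : linear AxA_lift.
Proof. exact: (tlift_lin AxA_lift_bal). Qed.

Lemma AxA_liftE x y : AxA_lift (atens x y) = psi x * gd G (psi y).
Proof. exact: (tlift_tmk _ _ AxA_lift_bal). Qed.

Lemma AxA_lift_lact a t : AxA_lift (lact a t) = psi a * AxA_lift t.
Proof.
elim/AxA_ind: t => [|x y t IH].
  by rewrite (lin0 (lact_linr a)) (lin0 AxA_lift_lin) mulr0.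
rewrite (linD (lact_linr a)) !(linD AxA_lift_lin) IH mulrDr.
by rewrite lact_atens !AxA_liftE psiM mulrA.
Qed.

(** By the Leibniz rule [AxA_lift] is not right [A]-linear; the defect vanishes
    precisely on the kernel of the product map, which is why the 1-forms are
    taken there. *)
Lemma AxA_lift_ract t a :
  AxA_lift (ract t a) = AxA_lift t * psi a + psi (mulmap t) * gd G (psi a).
Proof.
elim/AxA_ind: t => [|x y t IH].
  rewrite (lin0 (ract_linl a)) (lin0 AxA_lift_lin) (lin0 (@mulmap_lin K A)).
  by rewrite (lin0 psi_lin) !mul0r addr0.
rewrite (linD (ract_linl a)) !(linD AxA_lift_lin) IH (linD (@mulmap_lin K A)).
rewrite (linD psi_lin) !mulrDl [RHS]addrACA; congr (_ + _).
rewrite ract_atens !AxA_liftE mulmapE !psiM gd_leibniz0 ?psi_deg //.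
by rewrite mulrDr !mulrA.
Qed.

Definition Om1_lift (w : Om1 A) : G := AxA_lift (Om1_val w).

Lemma Om1_lift_lin : linear Om1_lift.
Proof. exact: (lin_comp (@Om1_val_lin K A) AxA_lift_lin). Qed.

Lemma Om1_lift_lact a w : Om1_lift (lact a w) = psi a * Om1_lift w.
Proof. exact: AxA_lift_lact. Qed.

Lemma Om1_lift_ract w a : Om1_lift (ract w a) = Om1_lift w * psi a.
Proof.
by rewrite /Om1_lift Om1_val_ract AxA_lift_ract Om1P (lin0 psi_lin) mul0r addr0.
Qed.

Lemma Om1_lift_du a : Om1_lift (du a) = gd G (psi a).
Proof.
rewrite /Om1_lift Om1_val_du (linB AxA_lift_lin) !AxA_liftE psi_hom.2.1.
by rewrite gd_1 mul1r mulr0 subr0.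
Qed.

Lemma Om1_lift_deg w : gdeg G 1 (Om1_lift w).
Proof.
rewrite /Om1_lift; elim/AxA_ind: (Om1_val w) => [|x y t IH].
  by rewrite (lin0 AxA_lift_lin); exact: gdeg_0.
rewrite (linD AxA_lift_lin) AxA_liftE; apply: gdegD => //.
(* [gd_deg] gives the degree [0 + 1], which is convertible to [1]. *)
by rewrite -[1](add0r 1); apply: gdeg_mul (psi_deg x) (gd_deg (psi_deg y)).
Qed.

Definition Omega_u_hom : Omega_u A -> G := @talg_hom K A (Om1 A) G psi Om1_lift.


Lemma Omega_u_hom_alg : is_alg_hom Omega_u_hom.
Proof.
exact: (talg_hom_alg psi_hom Om1_lift_lin Om1_lift_lact Om1_lift_ract).
Qed.

Lemma Omega_u_hom0 (a : A) : Omega_u_hom (@tin K A (Om1 A) 0 a) = psi a.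
Proof. exact: (talg_hom_tin psi_hom Om1_lift_lin Om1_lift_lact Om1_lift_ract). Qed.

Lemma Omega_u_hom1 w : Omega_u_hom (@tin K A (Om1 A) 1 w) = Om1_lift w.
Proof. exact: (talg_hom1 psi_hom Om1_lift_lin Om1_lift_lact Om1_lift_ract). Qed.

Let h_lin : linear Omega_u_hom. Proof. exact: Omega_u_hom_alg.1. Qed.
Let hM (x y : talg (Om1 A)) :
  Omega_u_hom (x * y) = Omega_u_hom x * Omega_u_hom y.
Proof. exact: Omega_u_hom_alg.2.2. Qed.

Lemma Omega_u_hom_deg n x : gdeg (Omega_u A) n x -> gdeg G n (Omega_u_hom x).
Proof.
case: n => n /=; last by move=> ->; rewrite (lin0 h_lin); exact: gdeg_0.
move=> [t ->{x}]; elim: n t => [|n IH] t; first by rewrite Omega_u_hom0.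
elim/tpow_ind: t => [|w t u IHu].
  by rewrite (lin0 (@tin_lin _ _ _ _)) (lin0 h_lin); exact: gdeg_0.
rewrite (linD (@tin_lin _ _ _ _)) (linD h_lin); apply: gdegD => //.
rewrite tin_cons hM Omega_u_hom1 -add1n PoszD.
by apply: gdeg_mul => //; exact: Om1_lift_deg.
Qed.

(** Writing a 1-form as a sum of [x d y], both sides are the sum of the
    [d (psi x) * d (psi y)]. *)
Lemma Omega_u_hom_du1 w :
  Omega_u_hom (@tin K A (Om1 A) 2 (du1 w)) = gd G (Om1_lift w).
Proof.
rewrite /du1 /Om1_lift; elim/AxA_ind: (Om1_val w) => [|x y t IH].
  rewrite (lin0 (@dAxA_lin K A)) (lin0 (@tin_lin _ _ _ _)) (lin0 h_lin).
  by rewrite (lin0 AxA_lift_lin) (lin0 (@gd_lin K G)).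
rewrite (linD (@dAxA_lin K A)) (linD (@tin_lin _ _ _ _)) (linD h_lin) IH.
rewrite (linD AxA_lift_lin) (linD (@gd_lin K G)); congr (_ + _).
rewrite dAxAE tin_cons hM !Omega_u_hom1 !Om1_lift_du AxA_liftE.
by rewrite gd_leibniz0 // gd_sq mulr0 addr0.
Qed.

(** In a product [w (x) t] with [w] of degree 1 the Leibniz rules of the two
    algebras have the same sign, so that the claim for [t] and for [w]
    ([Omega_u_hom_du1]) gives it for the product. *)
Lemma Omega_u_hom_d x : Omega_u_hom (gd (Omega_u A) x) = gd G (Omega_u_hom x).
Proof.
change (Omega_u_hom (dU x) = gd G (Omega_u_hom x)).
have hd_lin := lin_comp (@dU_lin K A) h_lin.
have dh_lin := lin_comp h_lin (@gd_lin K G).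
elim/talg_lin_ind: x => [x y IH IH'|n t].
  by rewrite (linD hd_lin) (linD dh_lin) IH IH'.
elim: n t => [|n IH] t.
  by rewrite dU_0 Omega_u_hom1 Om1_lift_du Omega_u_hom0.
elim/tpow_ind: t => [|w t u IHu].
  by rewrite (lin0 (@tin_lin _ _ _ _)) (lin0 hd_lin) (lin0 dh_lin).
rewrite (linD (@tin_lin _ _ _ _)) (linD hd_lin) (linD dh_lin) IHu; congr (_ + _).
rewrite tin_cons dU_cons (linB h_lin) !hM IH Omega_u_hom_du1 Omega_u_hom1.
by rewrite (gd_leibniz _ (Om1_lift_deg w)) mulN1r.
Qed.

Lemma Omega_u_hom_gda : is_gda_hom Omega_u_hom.
Proof.
split; [exact: Omega_u_hom_alg | exact: Omega_u_hom_deg | exact: Omega_u_hom_d].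
Qed.

End OmegaUUniversal.

(** [Omega_u A] is generated by [A] and by the [du a]: every 1-form is a sum of
    [x d y] ([AxA_duE]), and every tensor is a sum of products of 1-forms. *)
Lemma Omega_u_hom_unique (K : fieldType) (A : ualg K) (G : gda K)
    (F F' : Omega_u A -> G) :
  is_gda_hom F -> is_gda_hom F' ->
  (forall a : A, F (@tin K A (Om1 A) 0 a) = F' (@tin K A (Om1 A) 0 a)) ->
  F =1 F'.
Proof.
case=> [[Fl [_ FM]] _ Fd] [[Fl' [_ FM']] _ Fd'] FF0.
have FF1 (w : Om1 A) : F (@tin K A (Om1 A) 1 w) = F' (@tin K A (Om1 A) 1 w).
  rewrite (AxA_duE w); elim/AxA_ind: (Om1_val w) => [|a b t IH].
    by rewrite (lin0 (@AxA_du_lin K A)) (lin0 (@tin_lin _ _ _ _)) (lin0 Fl) (lin0 Fl').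
  rewrite (linD (@AxA_du_lin K A)) (linD (@tin_lin _ _ _ _)) (linD Fl) (linD Fl') IH.
  congr (_ + _); rewrite AxA_du_atens (@tin_lact K A (Om1 A) 1) -dU_0.
  by rewrite FM FM' FF0; congr (_ * _); rewrite [LHS]Fd [RHS]Fd' FF0.
move=> x; elim/talg_lin_ind: x => [x y IH IH'|n t].
  by rewrite (linD Fl) (linD Fl') IH IH'.
elim: n t => [|n IH] t; first exact: FF0.
elim/tpow_ind: t => [|w t u IHu].
  by rewrite (lin0 (@tin_lin _ _ _ _)) (lin0 Fl) (lin0 Fl').
rewrite (linD (@tin_lin _ _ _ _)) (linD Fl) (linD Fl') IHu tin_cons.
by rewrite FM FM' FF1 IH.
Qed.

(** * Composites and quotients *)

Lemma alg_hom_comp (K : pzRingType) (A B C : ualg K) (f : A -> B) (g : B -> C) :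
  is_alg_hom f -> is_alg_hom g -> is_alg_hom (fun x => g (f x)).
Proof.
case=> [fl [f1 fM]] [gl [g1 gM]]; split; first exact: (lin_comp fl gl).
by split=> [|x y]; rewrite ?f1 ?g1 ?fM ?gM.
Qed.

Lemma gda_hom_comp (K : fieldType) (G H L : gda K) (F : G -> H) (F' : H -> L) :
  is_gda_hom F -> is_gda_hom F' -> is_gda_hom (fun x => F' (F x)).
Proof.
case=> [Fa Fdeg Fd] [Fa' Fdeg' Fd'].
split=> [|n x hx|x]; last by rewrite Fd Fd'.
- exact: (alg_hom_comp Fa Fa').
- exact/Fdeg'/Fdeg.
Qed.

Section QuotientUniversal.
Variables (K : fieldType) (G : gda K) (I : dg_ideal G).

Lemma qgda_proj_gda : @is_gda_hom K G (qgda I) (qgda_proj I).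
Proof.
split=> [|n x hx|x]; first split; first exact: qgda_proj_lin.
- by split; [exact: qgda_proj1 | exact: qgda_projM].
- by exists x.
- by rewrite -qgda_d_proj.
Qed.

Variables (H : gda K) (F : G -> H).
Hypothesis F_hom : is_gda_hom F.
Hypothesis F_I : forall x, I x -> F x = 0.

Definition qgda_lift (q : qgda I) : H := F (qrepr q).

Lemma qgda_lift_proj x : qgda_lift (qgda_proj I x) = F x.
Proof.
exact: (qlift_pi x (gda_hom_alg F_hom).1 F_I).
Qed.

Lemma qgda_lift_gda : is_gda_hom qgda_lift.
Proof.
have [[Fl [F1 FM]] Fdeg Fd] := F_hom.
split=> [|n q [x hx ->]|q]; first split.
- move=> c p q; have [[x ->] [y ->]] := (qgda_proj_surj p, qgda_proj_surj q).
  by rewrite -qgda_proj_lin !qgda_lift_proj Fl.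
- split=> [|p q]; first by rewrite -[1](qgda_proj1 I) qgda_lift_proj.
  have [[x ->] [y ->]] := (qgda_proj_surj p, qgda_proj_surj q).
  by rewrite -qgda_projM !qgda_lift_proj FM.
- by rewrite qgda_lift_proj; exact: Fdeg.
- have [x ->] := qgda_proj_surj q.
  by rewrite [gd _ _]qgda_d_proj !qgda_lift_proj Fd.
Qed.

End QuotientUniversal.

(** * The universal property of the diagonal calculus *)

Section OmegaZUniversal.
Variables (K : fieldType) (A : ualg K) (G : gda K) (psi : A -> G).
Hypothesis psi_hom : is_alg_hom psi.
Hypothesis psi_deg : forall a, gdeg G 0 (psi a).
Hypothesis psi_center : forall z a : A, central z ->
  psi z * gd G (psi a) = gd G (psi a) * psi z.

(** The image of [x d y] is [psi x * d (psi y)]; [psi z] commutes with the first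
    factor because [z] is central in [A], with the second one by hypothesis. *)
Lemma Om1_lift_center (z : A) (w : Om1 A) : central z ->
  psi z * Om1_lift psi w = Om1_lift psi w * psi z.
Proof.
move=> zc; have [psi_lin [_ psiM]] := psi_hom.
have lin := AxA_lift_lin psi_hom.
rewrite /Om1_lift; elim/AxA_ind: (Om1_val w) => [|x y t IH].
  by rewrite (lin0 lin) mulr0 mul0r.
rewrite (linD lin) mulrDr mulrDl IH; congr (_ + _).
rewrite (AxA_liftE psi_hom) mulrA -psiM zc psiM -!mulrA; congr (_ * _).
exact: psi_center.
Qed.

Lemma Om1_lift_comm_center (w : Om1 A) :
  comm_center_Om1 w -> Om1_lift psi w = 0.
Proof.
have lin := Om1_lift_lin psi_hom.
elim=> [_ [z [m [zc ->]]]||m n _ hm _ hn|a m _ hm|m a _ hm].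
- rewrite (linB lin) (Om1_lift_lact psi_hom) (Om1_lift_ract psi_hom psi_deg).
  by rewrite Om1_lift_center // subrr.
- exact: lin0 lin.
- by rewrite (linD lin) hm hn addr0.
- by rewrite (Om1_lift_lact psi_hom) hm mulr0.
- by rewrite (Om1_lift_ract psi_hom psi_deg) hm mul0r.
Qed.

Lemma Omega_u_hom_IZ (x : Omega_u A) : IZ x -> Omega_u_hom psi x = 0.
Proof.
have [[lin [_ hM]] _ hd] := Omega_u_hom_gda psi_hom psi_deg.
elim=> [_ [w hw [->|->]]||u v _ hu _ hv|a u _ hu|u a _ hu].
- by rewrite (Omega_u_hom1 psi_hom psi_deg) Om1_lift_comm_center.
- rewrite hd (Omega_u_hom1 psi_hom psi_deg) Om1_lift_comm_center //.
  exact: (lin0 (@gd_lin K G)).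
- exact: lin0 lin.
- by rewrite (linD lin) hu hv addr0.
- by rewrite hM hu mulr0.
- by rewrite hM hu mul0r.
Qed.

Theorem Omega_Z_universal :
  exists! F : Omega_Z A -> G,
    is_gda_hom F /\ (forall a : A, F (iota_Z a) = psi a).
Proof.
have h_hom := Omega_u_hom_gda psi_hom psi_deg.
have h_IZ (x : Omega_u A) : IZ_ideal A x -> Omega_u_hom psi x = 0.
  exact: Omega_u_hom_IZ.
exists (qgda_lift (I := IZ_ideal A) (Omega_u_hom psi)); split.
  split=> [|a]; first exact: (qgda_lift_gda h_hom h_IZ).
  rewrite /iota_Z (qgda_lift_proj h_hom h_IZ).
  exact: (Omega_u_hom0 psi_hom psi_deg).
move=> F [F_hom F0]; apply: functional_extensionality_dep => q.
have [x ->] := qgda_proj_surj q.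
rewrite (qgda_lift_proj h_hom h_IZ).
apply: (Omega_u_hom_unique h_hom (gda_hom_comp (qgda_proj_gda _) F_hom)) => a.
by rewrite (Omega_u_hom0 psi_hom psi_deg) -F0.
Qed.

End OmegaZUniversal.

(** * Functoriality *)

Lemma iota_Z_comm_d (K : fieldType) (B : ualg K) (z b : B) : central z ->
  iota_Z z * gd (Omega_Z B) (iota_Z b) = gd (Omega_Z B) (iota_Z b) * iota_Z z.
Proof.
move=> zc; rewrite /iota_Z [gd _ _]qgda_d_proj [gd _ _]dU_0.
rewrite -2!(qgda_projM (IZ_ideal B)); apply/qgda_pi_eq.
rewrite -(@tin_lact K B (Om1 B) 1) -tin_ract1 -(linB (@tin_lin _ _ _ _)).
apply: ideal_gen; exists (lact z (du b) - ract (du b) z); last by left.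
by apply: subbimod_gen; exists z, (du b).
Qed.

Theorem Omega_Z_functorial (K : fieldType) (A B : ualg K) (phi : A -> B) :
  is_alg_hom phi -> (forall z : A, central z -> central (phi z)) ->
  exists! F : Omega_Z A -> Omega_Z B,
    is_gda_hom F /\ (forall a : A, F (iota_Z a) = iota_Z (phi a)).
Proof.
move=> phi_hom phi_center.
apply: (@Omega_Z_universal _ A (Omega_Z B) (fun a => iota_Z (phi a))).
- exact: (alg_hom_comp phi_hom (iota_Z_hom B)).
- by move=> a; apply/iota_Z_deg0; exists (phi a).
- by move=> z a zc; apply/iota_Z_comm_d/phi_center.
Qed.

Theorem corollary3 (R : realType) (A B : ualg R[i]) (phi : A -> B)
    (phi_hom : is_alg_hom phi)
    (phi_center : forall z : A, central z -> central (phi z)) :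
  exists! F : Omega_Z A -> Omega_Z B,
    is_gda_hom F /\ (forall a : A, F (iota_Z a) = iota_Z (phi a)).
Proof.
exact: (Omega_Z_functorial phi_hom phi_center).
Qed.
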